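(* Let $A\in\mathcal{A}_{n,1}$ and $\Omega=\Phi(\Lambda(A))$. Then $\overline{\Omega}=\Phi(\Lambda(\overline{A}))$, where $\overline{\Omega}$ is the dual of $\Omega$ (defined in the context).
   Context: An alternating sign matrix (ASM) of order $n$ is an $n\times n$ matrix $A=(a_{ij})$ with entries in $\{-1,0,1\}$ such that in every row and every column the nonzero entries alternate in sign, the first and the last nonzero entries being $1$. $\mathcal{A}_{n,1}$ denotes the set of order-$n$ ASMs having exactly one entry equal to $-1$. For an ASM $A=(a_{ij})$, $\overline{A}=(a_{i,n+1-j})$ is the vertical reflection of $A$. Let $A\in\mathcal{A}_{n,1}$. The opening column is the column containing the unique $-1$; the closing row is the row containing the $-1$; the opening row is the row of the $1$ of the opening column lying above the $-1$. The columns strictly to the left (resp. right) of the opening column form the left side (resp. right side). The closing row contains exactly two $1$'s, one in each side; the one in the right side is the closing $1$ and its column is the closing column. The rows strictly between the opening row and the closing row are the enclosed rows. $A$ is neutral if there are no enclosed rows; otherwise $A$ is positive if the $1$ of the lowest enclosed row lies in the right side, and negative if it lies in the left side. $\mathcal{A}_{n,1}^{+},\mathcal{A}_{n,1}^{0},\mathcal{A}_{n,1}^{-}$ denote the sets of positive, neutral, negative elements of $\mathcal{A}_{n,1}$; $A$ is negative iff $\overline{A}$ is positive. For $A\in\mathcal{A}_{n,1}^{+}\cup\mathcal{A}_{n,1}^{0}$: the charged cell is the intersection of the enclosed rows with the right side; the extended neutral cell is the intersection of the rows from the opening row to the closing row (inclusive) with the left side. The leading $1$ is the highest $1$ in the left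 side strictly below the opening row; its column is the leading column; the leading cell consists of the entries strictly below the opening row and strictly between the leading column and the opening column, and $\ell(A)$ is the sum of its entries. The closing cell consists of the entries strictly below the closing row and strictly between the opening column and the closing column, and $c(A)$ is the sum of its entries; the extended closing cell consists of the entries strictly below the closing row in the columns from the opening column to the closing column inclusive. If $A$ is positive, $E(A)$ is the sum of the entries of the charged cell; if $A$ is neutral, $E(A)=0$. Horizontal displacement: for an $m\times q$ $(0,1)$-matrix $P$ whose nonzero columns are $j_1<\dots<j_t$ with $j_1=1$ and $j_t<q$, $H(P)$ is the $m\times q$ matrix whose column $j_{s+1}$ equals column $j_s$ of $P$ for $1\le s\le t$ (where $j_{t+1}=q$), all other columns being zero. Vertical displacement: for an $m\times q$ $(0,1)$-matrix $P$ whose nonzero rows are $i_1<\dots<i_t$ with $i_1>1$ and $i_t=m$, $V(P)$ is the $m\times q$ matrix whose row $i_{s-1}$ equals row $i_s$ of $P$ for $1\le s\le t$ (where $i_0=1$), all other rows being zero. Partial discharging procedure: for $A\in\mathcal{A}_{n,1}^{+}\cup\mathcal{A}_{n,1}^{0}$, $\delta(A)$ is obtained by applying successively the following steps (all cells, rows and columns referring to the positions they occupy in $A$): (1) replace the $-1$ and the closing $1$ by $0$; (2) replace the submatrix occupying the extended closing cell by its image under $H$; (3) replace the submatrix occupying the extended neutral cell by its image under $V$; (4) lower the entries of the extended neutral cell and of the charged cell by one row: in the left side, for each row $t$ strictly below the opening row up to and including the closing row, the left part of row $t$ becomes the former left part of row $t-1$, and the left part of the opening row becomes zero; in the right side, for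 each row $t$ from two rows below the opening row up to and including the closing row, the right part of row $t$ becomes the former right part of row $t-1$, and the right part of the row immediately below the opening row becomes zero. The complete discharging procedure is $\Delta(A)=(k,\delta(A),c(A),E(A))$, where $k$ is the index of the opening row of $A$. It is known that $\Delta$ is injective on $\mathcal{A}_{n,1}^{+}\cup\mathcal{A}_{n,1}^{0}$, and that whenever $\Delta(A)=(k,P,c,E)$, there is a unique $N\in\mathcal{A}_{n,1}^{+}\cup\mathcal{A}_{n,1}^{0}$ with $\Delta(N)=(k,P,c+E,0)$, and this $N$ is neutral. Neutralizing procedure $\Lambda$: for $A\in\mathcal{A}_{n,1}^{+}\cup\mathcal{A}_{n,1}^{0}$ with $\Delta(A)=(k,P,c,E)$, $\Lambda(A)=(N,E)$ where $N$ is the unique element with $\Delta(N)=(k,P,c+E,0)$. For $A\in\mathcal{A}_{n,1}^{-}$, write $\Lambda(\overline{A})=(M,-E)$ and set $\Lambda(A)=(\overline{M},E)$. $\Lambda$ takes values in $\mathcal{N}_{n,1}=\{(N,E)\,:\,N\in\mathcal{A}_{n,1}^{0},\ E\in\mathbb{Z},\ -\ell(N)\le E\le c(N)\}$. Generalized inversion table: for $(N,E)\in\mathcal{N}_{n,1}$, let $n+1-k$ be the index of the opening row of $N$ (so the closing row is row $n+2-k$). For $1\le i\le n$, $a_i$ is the sum of the entries of $N$ lying strictly below row $n+1-i$ and strictly to the left of the unique $1$ of row $n+1-i$ (for $i=k-1$, i.e. the closing row, the leftmost $1$ of that row is used). Let $b=c(N)$ and $\beta=E+\ell(N)$. The generalized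 inversion table of $(N,E)$ is $(k;a_1,\dots,a_n;b,\beta)$. Mixed configurations: let $\mathcal{G}_n=\{(x,y)\in\mathbb{Z}^2: 0\le x<y\le n\}$. Steps are $E=(1,0)$, $F=(1,0)$ (a distinct letter from $E$ with the same displacement), $S=(0,-1)$, $N=(1,1)$. A mixed path is a lattice path all of whose vertices lie in $\mathcal{G}_n$, given as a word $LR$ where the Left part $L$ is a word in $\{S,E\}$ and the Right part $R$ is a word in $\{F,N\}$; the vertex where $L$ ends and $R$ begins is the junction. An order-$n$ mixed configuration is a sequence $(\omega_1,\dots,\omega_n)$ of mixed paths such that for some permutation $\sigma$ of $\{1,\dots,n\}$, $\omega_i$ starts at $(0,i)$ and ends at $(\sigma(i)-1,\sigma(i))$, the Left parts are pairwise vertex-disjoint, and the Right parts are pairwise vertex-disjoint. $\mathcal{M}_{n,1}$ is the set of order-$n$ mixed configurations containing exactly one $N$-step (hence exactly one $S$-step). For $(N,E)\in\mathcal{N}_{n,1}$ with generalized inversion table $(k;a_1,\dots,a_n;b,\beta)$, $\Phi(N,E)=(\omega_1,\dots,\omega_n)$ where $\omega_i=E^{a_i}F^{i-1-a_i}$ for $i\notin\{k-1,k\}$, $\omega_{k-1}=E^{a_{k-1}}F^{\beta}NF^{k-2-a_{k-1}-\beta}$, and $\omega_k=E^{a_k}SE^{b}F^{k-2-a_k-b}$ (exponents denote repetition of steps; $\omega_i$ starts at $(0,i)$). Duality: for $\Omega\in\mathcal{M}_{n,1}$, its dual $\overline{\Omega}$ is the unique element of $\mathcal{M}_{n,1}$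 such that, with $\rho(x,y)=(y-1-x,y)$, the set of junctions of $\overline{\Omega}$ is the image under $\rho$ of the set of junctions of $\Omega$, the start vertex of the $S$-step of $\overline{\Omega}$ is $\rho$ of the start vertex of the $S$-step of $\Omega$, and the end vertex of the $N$-step of $\overline{\Omega}$ is $\rho$ of the end vertex of the $N$-step of $\Omega$. Equivalently, if $\Omega=\Phi(N,E)$ where $(N,E)$ has generalized inversion table $(k;a_1,\dots,a_n;b,\beta)$, then $\overline{\Omega}$ is given by the formulas defining $\Phi$ applied to $(k;\overline{a}_1,\dots,\overline{a}_n;\overline{b},\overline{\beta})$ with $\overline{a}_i=i-1-a_i$ ($i\ne k-1$), $\overline{a}_{k-1}=k-2-a_k-b$, $\overline{b}=a_k-1-a_{k-1}$, $\overline{\beta}=a_k+b-a_{k-1}-\beta-1$. *)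

(* Defs.v *)
(* Matrices are 1-indexed functions nat -> nat -> int;
   an order-n matrix is the restriction to rows/columns 1..n. *)
From HB Require Import structures.
From mathcomp Require Import all_boot all_order all_algebra.
Set Implicit Arguments. Unset Strict Implicit. Unset Printing Implicit Defensive.
Import Order.TTheory GRing.Theory Num.Theory.

Definition mat := nat -> nat -> int.

Definition inr (n i : nat) : bool := (1 <= i <= n)%N.

Definition mat_eq (n : nat) (A B : mat) : Prop :=
  forall i j, inr n i -> inr n j -> A i j = B i j.

Definition alt_seq (s : seq int) : bool :=
  match s with
  | [::] => false
  | x :: s' => [&& x == 1%R, last x s' == 1%R & path (fun u v => v == (- u)%R) x s']
  end.

Definition row_seq n (A : mat) i : seq int := [seq A i j | j <- iota 1 n].
Definition col_seq n (A : mat) j : seq int := [seq A i j | i <- iota 1 n].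

Definition is_ASM (n : nat) (A : mat) : Prop :=
  (forall i j, inr n i -> inr n j -> A i j \in [:: (-1)%R; 0%R; 1%R]) /\
  (forall i, inr n i -> alt_seq [seq x <- row_seq n A i | x != 0%R]) /\
  (forall j, inr n j -> alt_seq [seq x <- col_seq n A j | x != 0%R]).

Definition nneg (n : nat) (A : mat) : nat :=
  (\sum_(i <- iota 1 n) \sum_(j <- iota 1 n) (A i j == (-1)%R))%N.

Definition in_A1 (n : nat) (A : mat) : Prop := is_ASM n A /\ nneg n A = 1%N.

Definition bar (n : nat) (A : mat) : mat := fun i j => A i (n.+1 - j)%N.

Definition first_in (s : seq nat) (P : pred nat) : nat := head 0%N [seq x <- s | P x].

Definition cell_sum (A : mat) (r1 r2 c1 c2 : nat) : int :=
  (\sum_(r1 <= i < r2.+1) \sum_(c1 <= j < c2.+1) A i j)%R.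

Definition cl_row n (A : mat) : nat :=
  first_in (iota 1 n) (fun i => has (fun j => A i j == (-1)%R) (iota 1 n)).
Definition op_col n (A : mat) : nat :=
  first_in (iota 1 n) (fun j => A (cl_row n A) j == (-1)%R).
Definition op_row n (A : mat) : nat :=
  first_in (iota 1 (cl_row n A).-1) (fun i => A i (op_col n A) == 1%R).
Definition cl_col n (A : mat) : nat :=
  first_in (iota (op_col n A).+1 (n - op_col n A)) (fun j => A (cl_row n A) j == 1%R).

(* column of the leftmost 1 of row i (the unique 1 if the row has no -1) *)
Definition one_col n (A : mat) (i : nat) : nat :=
  first_in (iota 1 n) (fun j => A i j == 1%R).

(* neutral: no enclosed rows *)
Definition is_neutral n (A : mat) : bool := cl_row n A == (op_row n A).+1.
(* positive / negative: the 1 of the lowest enclosed row (row cl_row - 1)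
   lies in the right / left side *)
Definition is_positive n (A : mat) : bool :=
  ((op_row n A).+1 < cl_row n A)%N && (op_col n A < one_col n A (cl_row n A).-1)%N.
Definition is_negative n (A : mat) : bool :=
  ((op_row n A).+1 < cl_row n A)%N && (one_col n A (cl_row n A).-1 < op_col n A)%N.

Definition in_PN (n : nat) (A : mat) : Prop :=
  in_A1 n A /\ (is_positive n A || is_neutral n A).

(* E(A): sum of the charged cell (enclosed rows x right side) if A is
   positive, 0 if A is neutral *)
Definition Echg n (A : mat) : int :=
  if is_positive n A then
    cell_sum A (op_row n A).+1 (cl_row n A).-1 (op_col n A).+1 n
  else 0%R.

Definition lead_row n (A : mat) : nat :=
  first_in (iota (op_row n A).+1 (n - op_row n A))
    (fun i => has (fun j => A i j == 1%R) (iota 1 (op_col n A).-1)).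
Definition lead_col n (A : mat) : nat :=
  first_in (iota 1 (op_col n A).-1) (fun j => A (lead_row n A) j == 1%R).
Definition lval n (A : mat) : int :=
  cell_sum A (op_row n A).+1 n (lead_col n A).+1 (op_col n A).-1.
Definition cval n (A : mat) : int :=
  cell_sum A (cl_row n A).+1 n (op_col n A).+1 (cl_col n A).-1.

Definition colnz (m : nat) (P : mat) (c : nat) : bool :=
  has (fun r => P r c != 0%R) (iota 1 m).
Definition rownz (q : nat) (P : mat) (r : nat) : bool :=
  has (fun c => P r c != 0%R) (iota 1 q).

(* horizontal displacement H of an m x q matrix: column j_{s+1} receives
   column j_s (j_{t+1} = q), other columns are zero *)
Definition Hdisp (m q : nat) (P : mat) : mat := fun r c =>
  let prevs := [seq j <- iota 1 c.-1 | colnz m P j] in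
  if ((c == q) || colnz m P c) && (prevs != [::]) then P r (last 0%N prevs)
  else 0%R.

(* vertical displacement V of an m x q matrix: row i_{s-1} receives row
   i_s (i_0 = 1), other rows are zero *)
Definition Vdisp (m q : nat) (P : mat) : mat := fun r c =>
  let nexts := [seq i <- iota r.+1 (m - r) | rownz q P i] in
  if ((r == 1%N) || rownz q P r) && (nexts != [::]) then P (head 0%N nexts) c
  else 0%R.

Definition subm (A : mat) (r0 c0 : nat) : mat := fun i j => A (i + r0 - 1)%N (j + c0 - 1)%N.
Definition replace (A : mat) (r0 c0 m q : nat) (P : mat) : mat := fun i j =>
  if (r0 <= i < r0 + m)%N && (c0 <= j < c0 + q)%N then P (i - r0 + 1)%N (j - c0 + 1)%N
  else A i j.

Definition delta n (A : mat) : mat :=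
  let cr := cl_row n A in let oc := op_col n A in
  let orow := op_row n A in let cc := cl_col n A in
  let A1 : mat := fun i j =>
    if (i == cr) && ((j == oc) || (j == cc)) then 0%R else A i j in
  (* (2) extended closing cell: rows cr+1..n, columns oc..cc *)
  let m2 := (n - cr)%N in let q2 := (cc - oc).+1 in
  let A2 := replace A1 cr.+1 oc m2 q2 (Hdisp m2 q2 (subm A1 cr.+1 oc)) in
  (* (3) extended neutral cell: rows orow..cr, columns 1..oc-1 *)
  let m3 := (cr - orow).+1 in let q3 := oc.-1 in
  let A3 := replace A2 orow 1 m3 q3 (Vdisp m3 q3 (subm A2 orow 1)) in
  fun i j =>
    if (j < oc)%N then
      (if i == orow then 0%R
       else if (orow < i <= cr)%N then A3 i.-1 j else A3 i j)
    else if (oc < j)%N then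
      (if i == orow.+1 then 0%R
       else if (orow.+1 < i <= cr)%N then A3 i.-1 j else A3 i j)
    else A3 i j.

(* Neutralizing procedure Lambda (as a relation: Lambda(A) = (N,E))     *)

(* for A positive or neutral: Delta(A) = (k,P,c,E), N the element of
   A^+ \cup A^0 with Delta(N) = (k,P,c+E,0) *)
Definition Lambda_PN n (A N : mat) (E : int) : Prop :=
  in_PN n N /\ E = Echg n A /\ op_row n N = op_row n A /\
  mat_eq n (delta n N) (delta n A) /\
  cval n N = (cval n A + Echg n A)%R /\ Echg n N = 0%R.

Definition Lambda n (A N : mat) (E : int) : Prop :=
  if is_negative n A then
    exists M : mat, Lambda_PN n (bar n A) M (- E)%R /\ mat_eq n N (bar n M)
  else Lambda_PN n A N E.

Inductive step := sE | sF | sS | sN.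

Definition step_eqb (s t : step) : bool :=
  match s, t with
  | sE, sE | sF, sF | sS, sS | sN, sN => true | _, _ => false end.
Lemma step_eqP : Equality.axiom step_eqb.
Proof. by case; case; constructor. Qed.
HB.instance Definition _ := hasDecEq.Build step step_eqP.

Definition pt := (int * int)%type.

Definition move (p : pt) (s : step) : pt :=
  match s with
  | sE | sF => ((p.1 + 1)%R, p.2)
  | sS => (p.1, (p.2 - 1)%R)
  | sN => ((p.1 + 1)%R, (p.2 + 1)%R)
  end.

Definition verts (p : pt) (w : seq step) : seq pt := p :: scanl move p w.
Definition endpt (p : pt) (w : seq step) : pt := foldl move p w.

Definition isL (s : step) : bool := (s == sS) || (s == sE).
Definition isR (s : step) : bool := (s == sF) || (s == sN).

Definition lpart (w : seq step) := take (find (fun s => ~~ isL s) w) w.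
Definition rpart (w : seq step) := drop (find (fun s => ~~ isL s) w) w.
Definition wf_word (w : seq step) : bool := all isR (rpart w).

Definition junction (p : pt) (w : seq step) : pt := endpt p (lpart w).
Definition Lverts (p : pt) (w : seq step) := verts p (lpart w).
Definition Rverts (p : pt) (w : seq step) := verts (junction p w) (rpart w).

Definition inG (n : nat) (p : pt) : bool := ((0 <= p.1)%R && (p.1 < p.2)%R && (p.2 <= (Posz n))%R).

Definition startp (i : nat) : pt := (0%R, (Posz i)).

(* a configuration is the list (omega_1,...,omega_n) of words;
   omega_i = nth [::] Om (i-1) starts at (0,i) *)
Definition path_of (Om : seq (seq step)) (i : nat) : seq step := nth [::] Om i.-1.

Definition disj (s t : seq pt) : bool := all (fun p => p \notin t) s.

Definition in_M1 (n : nat) (Om : seq (seq step)) : Prop :=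
  [/\ size Om = n,
      (forall i, inr n i ->
         wf_word (path_of Om i) && all (inG n) (verts (startp i) (path_of Om i))),
      (exists sigma : nat -> nat,
         [/\ forall i, inr n i -> inr n (sigma i),
             forall i j, inr n i -> inr n j -> sigma i = sigma j -> i = j &
             forall i, inr n i ->
               endpt (startp i) (path_of Om i) = ((Posz (sigma i) - 1)%R, Posz (sigma i))]),
      (forall i j, inr n i -> inr n j -> i != j ->
         disj (Lverts (startp i) (path_of Om i)) (Lverts (startp j) (path_of Om j))
         && disj (Rverts (startp i) (path_of Om i)) (Rverts (startp j) (path_of Om j)))
    & (\sum_(i <- iota 1 n) count (pred1 sN) (path_of Om i))%N = 1%N].

Definition junctions (n : nat) (Om : seq (seq step)) (p : pt) : Prop :=
  exists2 i, inr n i & p = junction (startp i) (path_of Om i).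
Definition S_starts (n : nat) (Om : seq (seq step)) (p : pt) : Prop :=
  exists2 i, inr n i & exists2 t, (t < size (path_of Om i))%N &
    nth sE (path_of Om i) t = sS /\ p = nth p (verts (startp i) (path_of Om i)) t.
Definition N_ends (n : nat) (Om : seq (seq step)) (p : pt) : Prop :=
  exists2 i, inr n i & exists2 t, (t < size (path_of Om i))%N &
    nth sE (path_of Om i) t = sN /\ p = nth p (verts (startp i) (path_of Om i)) t.+1.

Definition rho (p : pt) : pt := ((p.2 - 1 - p.1)%R, p.2).

Definition is_dual (n : nat) (Om Om' : seq (seq step)) : Prop :=
  [/\ in_M1 n Om, in_M1 n Om',
      (forall q, junctions n Om' q <-> exists2 p, junctions n Om p & q = rho p),
      (forall q, S_starts n Om' q <-> exists2 p, S_starts n Om p & q = rho p) &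
      (forall q, N_ends n Om' q <-> exists2 p, N_ends n Om p & q = rho p)].

(* int -> nat, negative values truncated to 0 (never used on valid data) *)
Definition tn (z : int) : nat := match z with Posz m => m | Negz _ => 0%N end.

Definition ainv n (N : mat) (i : nat) : int :=
  let r := (n.+1 - i)%N in cell_sum N r.+1 n 1 (one_col n N r).-1.

Definition Phi n (N : mat) (E : int) : seq (seq step) :=
  let k := (n.+1 - op_row n N)%N in
  let a i := tn (ainv n N i) in
  let b := tn (cval n N) in
  let beta := tn (E + lval n N)%R in
  [seq (if i == k.-1 then
          nseq (a i) sE ++ nseq beta sF ++ [:: sN] ++ nseq (k - 2 - a i - beta)%N sF
        else if i == k then
          nseq (a i) sE ++ [:: sS] ++ nseq b sE ++ nseq (k - 2 - a i - b)%N sF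
        else nseq (a i) sE ++ nseq (i - 1 - a i)%N sF)
   | i <- iota 1 n].

(* Main.v *)
(** [Lambda] sends [A] to a neutral matrix [N] and an integer [E].  Since [delta] together
    with [cval] determines a neutral matrix, [Lambda] sends the reflection of [A] to the
    reflection of [N] and [- E].  Indeed, on a neutral matrix [delta] only erases the -1 and
    the closing 1 and displaces the extended closing cell.  The opening row is thus left
    intact and shows the opening column; below the closing row every column sums to 0 or 1,
    so [cval] counts the nonzero columns of the closing cell and reveals the closing column;
    and horizontal displacement is undone by reading each nonzero column off the next one.

    In an alternating sign matrix the entries below a 1 in its column sum to 0.  Hence the
    sums to the left and to the right below the unique 1 of a row add up to the number of
    rows below it, which is the rule a + abar = i - 1 for generalized inversion tables.
    Below the closing row of a neutral matrix, its three nonzero entries cut off four cells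
    whose sums reflection reverses; the remaining entries of the table are read off them. *)
From mathcomp Require Import all_boot all_order all_algebra.
From mathcomp Require Import zify.
Require Import Defs.
Set Implicit Arguments. Unset Strict Implicit. Unset Printing Implicit Defensive.
Import Order.TTheory GRing.Theory Num.Theory.
Local Open Scope ring_scope.

Lemma mem_iota1 n i : (i \in iota 1 n) = inr n i.
Proof. by rewrite mem_iota add1n ltnS. Qed.

Lemma first_in_unique (s : seq nat) (P : pred nat) p :
  p \in s -> P p -> {in s, forall q, P q -> q = p} -> first_in s P = p.
Proof.
move=> ps Pp uniqP; rewrite /first_in; have : p \in filter P s by rewrite mem_filter Pp.
case filterE: (filter P s) => [|q t] //= _.
have : q \in filter P s by rewrite filterE mem_head.
by rewrite mem_filter => /andP[Pq /uniqP]; apply.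
Qed.

Lemma first_in_cat (s t : seq nat) (P : pred nat) :
  has P s -> first_in (s ++ t) P = first_in s P.
Proof. by rewrite has_filter /first_in filter_cat; case: (filter P s). Qed.

Lemma eq_in_first_in (s : seq nat) (P Q : pred nat) :
  {in s, P =1 Q} -> first_in s P = first_in s Q.
Proof. by move=> eqPQ; rewrite /first_in (eq_in_filter eqPQ). Qed.

Lemma first_in_iota_leq n (P : pred nat) : (first_in (iota 1 n) P <= n)%N.
Proof.
rewrite /first_in; case filterE: (filter P (iota 1 n)) => [|i s] //=.
have : i \in filter P (iota 1 n) by rewrite filterE mem_head.
by rewrite mem_filter mem_iota1 => /and3P[].
Qed.

Lemma inr_reflect n j : inr n j -> inr n (n.+1 - j).
Proof. by rewrite /inr; lia. Qed.

Lemma mat_eq_sym n A B : mat_eq n A B -> mat_eq n B A.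
Proof. by move=> eqAB i j ni nj; rewrite eqAB. Qed.

Lemma mat_eq_trans n B A C : mat_eq n A B -> mat_eq n B C -> mat_eq n A C.
Proof. by move=> eqAB eqBC i j ni nj; rewrite eqAB ?eqBC. Qed.

Lemma eq_bar n A B : mat_eq n A B -> mat_eq n (bar n A) (bar n B).
Proof. by move=> eqAB i j ni nj; apply: eqAB (inr_reflect nj). Qed.

Lemma map_reflect_iota n a m : (a + m <= n.+2)%N ->
  [seq (n.+1 - j)%N | j <- iota a m] = rev (iota (n.+2 - (a + m)) m).
Proof.
move=> am; apply: (@eq_from_nth _ 0%N) => [|t]; rewrite ?size_rev ?size_map !size_iota // => tm.
by rewrite (nth_map 0%N) ?nth_rev ?size_iota // !nth_iota; lia.
Qed.

Lemma sum_bool2_eq1 (S T : eqType) (s : seq S) (t : seq T) (P : S -> T -> bool) :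
  (\sum_(i <- s) \sum_(j <- t) P i j = 1)%N ->
  exists i j, [/\ i \in s, j \in t, P i j &
    forall i' j', i' \in s -> j' \in t -> P i' j' -> i' = i /\ j' = j].
Proof.
rewrite -(@big_allpairs _ _ _ _ _ s t (fun p => nat_of_bool (P p.1 p.2))).
case/sum_nat_seq_eq1 => -[i j] [/allpairsP[[i0 j0] [/= is0 jt [-> ->]]] _ Pij others].
exists i0, j0; split=> //; first by case: (P i0 j0) Pij.
move=> i' j' is' jt' Pij'; have [[-> ->] //|ne] := eqVneq (i', j') (i0, j0).
by have := others _ ne (allpairs_f pair is' jt') isT; rewrite /= Pij'.
Qed.

(** * Sums over cells *)

Definition tr (A : mat) : mat := fun i j => A j i.

Lemma cell_sum_tr A r1 r2 c1 c2 : cell_sum (tr A) r1 r2 c1 c2 = cell_sum A c1 c2 r1 r2.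
Proof. exact: exchange_big. Qed.

Lemma cell_sum_rows A r1 r2 c1 c2 :
  cell_sum A r1 r2 c1 c2 = \sum_(r1 <= i < r2.+1) cell_sum A i i c1 c2.
Proof. by apply: eq_bigr => i _; rewrite /cell_sum big_nat1. Qed.

Lemma cell_sum_cols A r1 r2 c1 c2 :
  cell_sum A r1 r2 c1 c2 = \sum_(c1 <= j < c2.+1) cell_sum A r1 r2 j j.
Proof. by rewrite -cell_sum_tr cell_sum_rows; apply: eq_bigr => j _; apply: cell_sum_tr. Qed.

Lemma cell_sum11 A i j : cell_sum A i i j j = A i j.
Proof. by rewrite /cell_sum !big_nat1. Qed.

Lemma cell_sum_split_rows r A r1 r2 c1 c2 : (r1 <= r.+1)%N -> (r <= r2)%N ->
  cell_sum A r1 r2 c1 c2 = cell_sum A r1 r c1 c2 + cell_sum A r.+1 r2 c1 c2.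
Proof. by move=> r1r rr2; rewrite /cell_sum (@big_cat_nat _ _ _ r.+1). Qed.

Lemma cell_sum_split_cols c A r1 r2 c1 c2 : (c1 <= c.+1)%N -> (c <= c2)%N ->
  cell_sum A r1 r2 c1 c2 = cell_sum A r1 r2 c1 c + cell_sum A r1 r2 c.+1 c2.
Proof. by move=> c1c cc2; rewrite -!(cell_sum_tr A); apply: cell_sum_split_rows. Qed.

Lemma cell_sum_split_at c A r1 r2 c1 c2 : (0 < c)%N -> (c1 <= c <= c2)%N ->
  cell_sum A r1 r2 c1 c2 =
    cell_sum A r1 r2 c1 c.-1 + cell_sum A r1 r2 c c + cell_sum A r1 r2 c.+1 c2.
Proof.
case: c => // c _ /andP[c1c cc2]; rewrite -addrA.
by rewrite -cell_sum_split_cols ?leqnSn // -cell_sum_split_cols // ltnW.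
Qed.

Lemma cell_sum_ge0 A r1 r2 c1 c2 :
  (forall i j, (r1 <= i <= r2)%N -> (c1 <= j <= c2)%N -> 0 <= A i j) ->
  0 <= cell_sum A r1 r2 c1 c2.
Proof.
move=> A_ge0; rewrite /cell_sum big_nat_cond sumr_ge0 // => i /andP[ri _].
by rewrite big_nat_cond sumr_ge0 // => j /andP[cj _]; apply: A_ge0.
Qed.

Lemma ler_cell_sum A r1 r2 c1 c2 i j :
  (forall i j, (r1 <= i <= r2)%N -> (c1 <= j <= c2)%N -> 0 <= A i j) ->
  (r1 <= i <= r2)%N -> (c1 <= j <= c2)%N -> A i j <= cell_sum A r1 r2 c1 c2.
Proof.
move=> A_ge0 ri cj; rewrite /cell_sum (bigD1_seq i) ?iota_uniq ?mem_index_iota //=.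
rewrite (bigD1_seq j) ?iota_uniq ?mem_index_iota //= -addrA lerDl addr_ge0 //.
  by rewrite big_seq_cond sumr_ge0 // => j'; rewrite mem_index_iota => /andP[cj' _]; apply: A_ge0.
rewrite big_seq_cond sumr_ge0 // => i'; rewrite mem_index_iota => /andP[ri' _].
by rewrite big_seq sumr_ge0 // => j'; rewrite mem_index_iota => cj'; apply: A_ge0.
Qed.

Lemma cell_sum_eq0 A r1 r2 c1 c2 :
  (forall i j, (r1 <= i <= r2)%N -> (c1 <= j <= c2)%N -> A i j = 0) ->
  cell_sum A r1 r2 c1 c2 = 0.
Proof.
by move=> A0; rewrite /cell_sum big_nat big1 // => i ri; rewrite big_nat big1 // => j; apply: A0.
Qed.

Lemma eq_cell_sum n A B r1 r2 c1 c2 : mat_eq n A B -> (0 < r1)%N -> (0 < c1)%N ->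
  (r2 <= n)%N -> (c2 <= n)%N -> cell_sum A r1 r2 c1 c2 = cell_sum B r1 r2 c1 c2.
Proof.
move=> eqAB r1_gt0 c1_gt0 r2n c2n; apply: eq_big_nat => i ri; apply: eq_big_nat => j cj.
by apply: eqAB; rewrite /inr; lia.
Qed.

Lemma cell_sum_bar n A r1 r2 c1 c2 : (c1 <= c2.+1)%N -> (c2 <= n)%N ->
  cell_sum (bar n A) r1 r2 c1 c2 = cell_sum A r1 r2 (n.+1 - c2) (n.+1 - c1).
Proof.
move=> c12 c2n; apply: eq_bigr => i _; rewrite -(big_map (fun j => n.+1 - j)%N predT (A i)).
rewrite map_reflect_iota ?big_rev; last by lia.
by congr bigop; congr iota; lia.
Qed.

Definition zero_one_row (A : mat) i c1 c2 : Prop :=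
  forall j, (c1 <= j <= c2)%N -> A i j = 0 \/ A i j = 1.

Lemma row_first_one A i c1 c2 m (p := first_in (iota c1 m) (fun j => A i j == 1)) :
  (c2 < c1 + m)%N -> zero_one_row A i c1 c2 -> cell_sum A i i c1 c2 = 1 ->
  [/\ (c1 <= p <= c2)%N, A i p = 1 & forall j, (c1 <= j <= c2)%N -> j != p -> A i j = 0].
Proof.
move=> c2m A01; rewrite /cell_sum big_nat1 => sum1.
have : (\sum_(c1 <= j < c2.+1) (A i j == 1) = 1)%N.
  apply/eqP; rewrite -(eqr_nat int) natr_sum -[X in _ == X]sum1; apply/eqP/eq_big_nat => j cj.
  by case: (A01 j cj) => ->.
case/sum_nat_seq_eq1 => q []; rewrite mem_index_iota ltnS => cq _ Aq others.
have A0 j : (c1 <= j <= c2)%N -> j != q -> A i j = 0.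
  move=> cj jq; case: (A01 j cj) => // Aj.
  by have := others j jq; rewrite mem_index_iota ltnS cj Aj => /(_ isT isT).
have Aq1 : A i q = 1 by move: Aq; case: eqP.
suff -> : p = q by split.
have q_iota : q \in iota c1 (c2.+1 - c1) by rewrite mem_iota; lia.
rewrite /p -(@subnKC (c2.+1 - c1) m) ?iotaD; last by lia.
rewrite first_in_cat; last by apply/hasP; exists q; rewrite ?Aq1.
apply: first_in_unique => //; first by rewrite Aq1.
move=> j; rewrite mem_iota => cj /eqP Aj; apply/eqP; apply: contraT => jq.
by rewrite A0 // in Aj; lia.
Qed.

(** * Alternating sign matrices *)

Lemma alt_seqE (s : seq int) :
  alt_seq s = [&& head 0 s == 1, last 0 s == 1 & sorted (fun u v => v == - u) s].
Proof. by case: s. Qed.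

Lemma alt_seq_rev (s : seq int) : alt_seq (rev s) = alt_seq s.
Proof.
have -> : alt_seq s = [&& last 0 s == 1, head 0 s == 1 & sorted (fun u v => u == - v) s].
  rewrite alt_seqE andbCA; do 2!congr andb.
  by apply: eq_sorted => u v; rewrite eq_sym eqr_oppLR.
rewrite alt_seqE rev_sorted; have -> : head 0 (rev s) = last 0 s.
  by case/lastP: s => [|s x] //; rewrite rev_rcons last_rcons.
by have -> : last 0 (rev s) = head 0 s by case: s => [|x s] //; rewrite rev_cons last_rcons.
Qed.

Lemma alt_path_sum (x : int) (s : seq int) (t := [seq u <- s | u != 0]) :
  x = 1 \/ x = -1 -> path (fun u v => v == - u) x t ->
  (last x t = 1 \/ last x t = -1) /\ 2 * (\sum_(u <- s) u) = last x t - x.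
Proof.
rewrite {}/t; elim: s x => [|u s IHs] x x_sign /=; first by rewrite big_nil; lia.
rewrite big_cons; case: eqP => [->|_] /=; first by rewrite add0r; apply: IHs.
case/andP => /eqP uE /IHs; set l := last u _; case; first by lia.
by move=> l_sign sumE; split=> //; rewrite mulrDr sumE uE; lia.
Qed.

Lemma alt_seq_sum (s : seq int) : alt_seq [seq u <- s | u != 0] -> \sum_(u <- s) u = 1.
Proof.
set t := filter _ _ => alt_t; have [] := @alt_path_sum (-1) s; first by right.
  by move: alt_t; rewrite -/t; case: t => [|u t] //= /and3P[/eqP-> _ ->].
by move: alt_t; rewrite -/t; case: t => [|u t] //= /and3P[_ /eqP-> _] _; lia.
Qed.

Lemma alt_seq_sum_take (s : seq int) m : alt_seq [seq u <- s | u != 0] ->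
  0 <= \sum_(u <- take m s) u <= 1.
Proof.
move=> alt_s; have [] := @alt_path_sum (-1) (take m s); first by right.
  move: alt_s; rewrite -{1}(cat_take_drop m s) filter_cat.
  by case: (filter _ (take m s)) => [|u t] //=; rewrite cat_path => /and3P[/eqP-> _ /andP[->]].
by case=> ->; lia.
Qed.

Lemma is_ASM_tr n A : is_ASM n A -> is_ASM n (tr A).
Proof. by case=> entries [rows cols]; split=> // i j ni nj; apply: entries. Qed.

Lemma row_seq_bar n A i : row_seq n (bar n A) i = rev (row_seq n A i).
Proof.
have reflectE : [seq (n.+1 - j)%N | j <- iota 1 n] = rev (iota 1 n).
  by rewrite map_reflect_iota; [congr (rev _); congr iota|]; lia.
by rewrite /row_seq -map_rev -reflectE -map_comp.
Qed.

Lemma is_ASM_bar n A : is_ASM n A -> is_ASM n (bar n A).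
Proof.
case=> entries [rows cols]; split=> [i j ni nj|].
  by apply: entries => //; apply: inr_reflect.
split=> [i ni|j nj]; last exact/cols/inr_reflect.
by rewrite row_seq_bar filter_rev alt_seq_rev; apply: rows.
Qed.

Lemma is_ASM_eq n A B : mat_eq n A B -> is_ASM n A -> is_ASM n B.
Proof.
move=> eqAB [entries [rows cols]]; split.
  by move=> i j ni nj; rewrite -eqAB //; apply: entries.
split=> [i ni|j nj]; [move: (rows i ni)|move: (cols j nj)]; rewrite /row_seq /col_seq.
  by rewrite (@eq_in_map _ _ (A i) (B i) _).1 // => j; rewrite mem_iota1 => nj; apply: eqAB.
rewrite (@eq_in_map _ _ (A^~ j) (B^~ j) _).1 // => i; rewrite mem_iota1 => ni; exact: eqAB.
Qed.

Section AlternatingSums.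
Variables (n : nat) (A : mat).
Hypothesis asmA : is_ASM n A.

Lemma ASM_row_sum i : inr n i -> cell_sum A i i 1 n = 1.
Proof.
move=> ni; have [_ [rows _]] := asmA; have := alt_seq_sum (rows i ni).
by rewrite big_map /cell_sum big_nat1 /index_iota subn1.
Qed.

Lemma ASM_row_prefix i c : inr n i -> (c <= n)%N -> 0 <= cell_sum A i i 1 c <= 1.
Proof.
move=> ni cn; have [_ [rows _]] := asmA; have := alt_seq_sum_take c (rows i ni).
by rewrite -map_take take_iota (minn_idPl cn) big_map /cell_sum big_nat1 /index_iota subn1.
Qed.

Lemma ASM_row_suffix i c : inr n i -> (0 < c <= n.+1)%N -> 0 <= cell_sum A i i c n <= 1.
Proof.
move=> ni; case: c => // c /= cn; have := ASM_row_prefix ni cn; have := ASM_row_sum ni.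
by rewrite (cell_sum_split_cols (c := c)) //; lia.
Qed.

Lemma ASM_rows_sum r1 r2 : (0 < r1 <= r2.+1)%N -> (r2 <= n)%N ->
  cell_sum A r1 r2 1 n = (r2.+1 - r1)%:Z.
Proof.
move=> r12 r2n; rewrite cell_sum_rows.
rewrite (eq_big_nat _ _ (F2 := fun=> 1)) ?sumr_const_nat ?natz // => i ri.
by apply: ASM_row_sum; rewrite /inr; lia.
Qed.

Lemma ASM_prefix_ge0 r1 r2 c : (0 < r1)%N -> (r2 <= n)%N -> (c <= n)%N ->
  0 <= cell_sum A r1 r2 1 c.
Proof.
move=> r1_gt0 r2n cn; rewrite cell_sum_rows big_nat sumr_ge0 // => i ri.
have ni : inr n i by rewrite /inr; lia.
by have /andP[] := ASM_row_prefix ni cn.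
Qed.

Lemma ASM_suffix_ge0 r1 r2 c : (0 < r1)%N -> (r2 <= n)%N -> (0 < c <= n.+1)%N ->
  0 <= cell_sum A r1 r2 c n.
Proof.
move=> r1_gt0 r2n cn; rewrite cell_sum_rows big_nat sumr_ge0 // => i ri.
have ni : inr n i by rewrite /inr; lia.
by have /andP[] := ASM_row_suffix ni cn.
Qed.

End AlternatingSums.

Lemma ASM_col_sum n A j : is_ASM n A -> inr n j -> cell_sum A 1 n j j = 1.
Proof. by move=> asmA nj; rewrite -cell_sum_tr (ASM_row_sum (is_ASM_tr asmA) nj). Qed.

Lemma ASM_col_prefix n A r j : is_ASM n A -> inr n j -> (r <= n)%N ->
  0 <= cell_sum A 1 r j j <= 1.
Proof. by move=> asmA nj; rewrite -cell_sum_tr; apply: (ASM_row_prefix (is_ASM_tr asmA)). Qed.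

Lemma ASM_col_suffix n A r j : is_ASM n A -> inr n j -> (0 < r <= n.+1)%N ->
  0 <= cell_sum A r n j j <= 1.
Proof. by move=> asmA nj; rewrite -cell_sum_tr; apply: (ASM_row_suffix (is_ASM_tr asmA)). Qed.

Lemma ASM_sum_below_one n A i j : is_ASM n A -> inr n i -> inr n j -> A i j = 1 ->
  cell_sum A i.+1 n j j = 0.
Proof.
case: i => // i asmA /[dup] ni /andP[_ lt_in] nj Aij.
have := ASM_col_sum asmA nj; have := ASM_col_prefix asmA nj lt_in.
have := ASM_col_prefix asmA nj (ltnW lt_in).
rewrite (@cell_sum_split_rows i.+1 _ _ n) // (@cell_sum_split_rows i _ _ i.+1) // cell_sum11 Aij.
lia.
Qed.

Lemma ASM_minus_one_row_sums n A i j : is_ASM n A -> inr n i -> inr n j -> A i j = -1 ->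
  cell_sum A i i 1 j.-1 = 1 /\ cell_sum A i i j.+1 n = 1.
Proof.
move=> asmA ni /[dup] nj /andP[j_gt0 jn] Aij.
have [jpn jSn] : (j.-1 <= n)%N /\ (0 < j.+1 <= n.+1)%N by lia.
have := ASM_row_prefix asmA ni jpn; have := ASM_row_suffix asmA ni jSn.
have := ASM_row_sum asmA ni; rewrite (@cell_sum_split_at j) // cell_sum11 Aij; lia.
Qed.

Lemma ASM_minus_one_col_sums n A i j : is_ASM n A -> inr n i -> inr n j -> A i j = -1 ->
  cell_sum A 1 i.-1 j j = 1 /\ cell_sum A i.+1 n j j = 1.
Proof.
move=> asmA ni nj Aij; rewrite -!(cell_sum_tr A).
exact: ASM_minus_one_row_sums (is_ASM_tr asmA) nj ni Aij.
Qed.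

(** * Matrices with a single negative entry *)

Lemma nneg_row_seq n A :
  nneg n A = (\sum_(i <- iota 1 n) \sum_(x <- row_seq n A i) (x == (-1)%R))%N.
Proof. by apply: eq_bigr => i _; rewrite big_map. Qed.

Lemma in_A1_bar n A : in_A1 n A -> in_A1 n (bar n A).
Proof.
case=> asmA nnegA; split; first exact: is_ASM_bar.
by rewrite -nnegA !nneg_row_seq; apply: eq_bigr => i _; rewrite row_seq_bar big_rev.
Qed.

Lemma in_A1_eq n A B : mat_eq n A B -> in_A1 n A -> in_A1 n B.
Proof.
move=> eqAB [asmA nnegA]; split; first exact: is_ASM_eq eqAB asmA.
rewrite -nnegA; apply: eq_big_seq => i; rewrite mem_iota1 => ni.
by apply: eq_big_seq => j; rewrite mem_iota1 => nj; rewrite eqAB.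
Qed.

Definition left_col n (A : mat) : nat := one_col n A (cl_row n A).

Section SingleNegative.
Variables (n : nat) (A : mat).
Hypothesis A_in : in_A1 n A.

Local Notation cr := (cl_row n A).
Local Notation oc := (op_col n A).
Local Notation orow := (op_row n A).
Local Notation cc := (cl_col n A).
Local Notation lc := (left_col n A).

Lemma minus_oneP :
  [/\ inr n cr, inr n oc, A cr oc = -1 &
      forall i j, inr n i -> inr n j -> A i j = -1 -> i = cr /\ j = oc].
Proof.
have [i [j [ni nj /eqP Aij only]]] := sum_bool2_eq1 A_in.2.
have crE : cr = i.
  apply: first_in_unique => //; first by apply/hasP; exists j; rewrite ?Aij.
  by move=> i' ni' /hasP[j' nj' /(only _ _ ni' nj')[]].
have ocE : oc = j.
  rewrite /op_col crE; apply: first_in_unique; rewrite ?Aij //.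
  by move=> j' nj' /(only _ _ ni nj')[].
rewrite !mem_iota1 in ni nj; rewrite crE ocE; split=> // i' j' ni' nj' /eqP Aij'.
by apply: only; rewrite ?mem_iota1.
Qed.

Lemma inr_cl_row : inr n cr. Proof. by case: minus_oneP. Qed.

Lemma inr_op_col : inr n oc. Proof. by case: minus_oneP. Qed.

Lemma cl_row_op_col : A cr oc = -1. Proof. by case: minus_oneP. Qed.

Lemma minus_one_unique i j : inr n i -> inr n j -> A i j = -1 -> i = cr /\ j = oc.
Proof. by case: minus_oneP => _ _ _; apply. Qed.

Lemma entry_zero_one i j : inr n i -> inr n j -> (i != cr) || (j != oc) -> A i j = 0 \/ A i j = 1.
Proof.
move=> ni nj ij; have [[entries _] _] := A_in; move: (entries i j ni nj); rewrite !inE.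
case/or3P => /eqP Aij; [|by left|by right].
by have [iE jE] := minus_one_unique ni nj Aij; rewrite iE jE !eqxx in ij.
Qed.

Lemma entry_ge0 i j : inr n i -> inr n j -> (i != cr) || (j != oc) -> 0 <= A i j.
Proof. by move=> ni nj ij; case: (entry_zero_one ni nj ij) => ->. Qed.

Lemma op_rowP :
  [/\ (0 < orow < cr)%N, A orow oc = 1 & forall i, (0 < i < cr)%N -> i != orow -> A i oc = 0].
Proof.
have [[/andP[_ crn] /andP[oc_gt0 ocn]] [asmA _]] := (inr_cl_row, inr_op_col, A_in).
have [above _] := ASM_minus_one_col_sums asmA inr_cl_row inr_op_col cl_row_op_col.
have [|||op_row_lt Ao others] := @row_first_one (tr A) oc 1 cr.-1 cr.-1.
- by rewrite add1n ltnSn.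
- by move=> i ci; apply: entry_zero_one; rewrite /inr; lia.
- by rewrite cell_sum_tr.
split=> [||i i_in]; [|exact: Ao|by apply: others; lia].
by move: (op_row_lt : 0 < orow <= cr.-1)%N; lia.
Qed.

Lemma cl_colP :
  [/\ (oc < cc <= n)%N, A cr cc = 1 & forall j, (oc < j <= n)%N -> j != cc -> A cr j = 0].
Proof.
have [/andP[cr_gt0 crn] [asmA _]] := (inr_cl_row, A_in).
have [_ right] := ASM_minus_one_row_sums asmA inr_cl_row inr_op_col cl_row_op_col.
apply: row_first_one right; first by lia.
by move=> j cj; apply: entry_zero_one; rewrite /inr; lia.
Qed.

Lemma left_colP :
  [/\ (0 < lc < oc)%N, A cr lc = 1 & forall j, (0 < j < oc)%N -> j != lc -> A cr j = 0].
Proof.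
have [[/andP[cr_gt0 crn] /andP[_ ocn]] [asmA _]] := (inr_cl_row, inr_op_col, A_in).
have [left _] := ASM_minus_one_row_sums asmA inr_cl_row inr_op_col cl_row_op_col.
have [||left_col_lt Al others] := @row_first_one A cr 1 oc.-1 n _ _ left; first by lia.
  by move=> j cj; apply: entry_zero_one; rewrite /inr; lia.
split=> [||j j_in]; [|exact: Al|by apply: others; lia].
by move: (left_col_lt : 0 < lc <= oc.-1)%N; lia.
Qed.

Lemma one_colP i : inr n i -> i != cr ->
  [/\ inr n (one_col n A i), A i (one_col n A i) = 1 &
      forall j, inr n j -> j != one_col n A i -> A i j = 0].
Proof.
move=> ni i_neq; apply: row_first_one (ASM_row_sum A_in.1 ni); first by rewrite add1n.
by move=> j nj; apply: entry_zero_one; rewrite ?i_neq.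
Qed.

Lemma positions_ordered :
  [/\ (0 < orow < cr)%N, (cr <= n)%N, (0 < lc < oc)%N & (oc < cc <= n)%N].
Proof.
by have [[? _ _] [? _ _] [? _ _] /andP[]] := And4 op_rowP left_colP cl_colP inr_cl_row.
Qed.

Lemma op_row_unique i : (0 < i < cr)%N -> A i oc = 1 -> i = orow.
Proof.
move=> i_in Ai; have [_ _ others] := op_rowP.
by apply/eqP; apply: contraT => /(others i i_in); rewrite Ai.
Qed.

Lemma cl_col_unique j : (oc < j <= n)%N -> A cr j = 1 -> j = cc.
Proof.
move=> j_in Aj; have [_ _ others] := cl_colP.
by apply/eqP; apply: contraT => /(others j j_in); rewrite Aj.
Qed.

Lemma left_col_unique j : (0 < j < oc)%N -> A cr j = 1 -> j = lc.
Proof.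
move=> j_in Aj; have [_ _ others] := left_colP.
by apply/eqP; apply: contraT => /(others j j_in); rewrite Aj.
Qed.

Lemma one_col_unique i j : inr n i -> i != cr -> inr n j -> A i j = 1 -> j = one_col n A i.
Proof.
move=> ni i_neq nj Aij; have [_ _ others] := one_colP ni i_neq.
by apply/eqP; apply: contraT => /(others j nj); rewrite Aij.
Qed.

Lemma one_col_op_row : one_col n A orow = oc.
Proof.
have [[op_row_lt ? ? ?] [_ Ao _]] := (positions_ordered, op_rowP).
by symmetry; apply: one_col_unique inr_op_col Ao; rewrite /inr; lia.
Qed.

Lemma one_col_enclosed i : (orow < i < cr)%N -> one_col n A i != oc.
Proof.
move=> i_in; have [_ cl_row_le _ _] := positions_ordered.
have [||_ Ai _] := @one_colP i; [by rewrite /inr; lia|by lia|].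
apply/eqP => iE; rewrite iE in Ai; have := op_row_unique _ Ai; lia.
Qed.

End SingleNegative.

Section Reflection.
Variables (n : nat) (A : mat).
Hypothesis A_in : in_A1 n A.

Let barA_in : in_A1 n (bar n A) := in_A1_bar A_in.

Lemma bar_reflect i j : (j <= n)%N -> bar n A i (n.+1 - j)%N = A i j.
Proof. by move=> jn; rewrite /bar subKn // ltnW. Qed.

Lemma cl_row_op_col_bar :
  cl_row n (bar n A) = cl_row n A /\ op_col n (bar n A) = (n.+1 - op_col n A)%N.
Proof.
have [[_ _ left_col_lt cl_col_lt] nr] := (positions_ordered A_in, inr_cl_row A_in).
have [||->->] // := minus_one_unique barA_in nr (j := n.+1 - op_col n A).
  by rewrite /inr; lia.
by rewrite bar_reflect ?cl_row_op_col //; lia.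
Qed.

Lemma cl_row_bar : cl_row n (bar n A) = cl_row n A. Proof. by case: cl_row_op_col_bar. Qed.

Lemma op_col_bar : op_col n (bar n A) = (n.+1 - op_col n A)%N.
Proof. by case: cl_row_op_col_bar. Qed.

Lemma op_row_bar : op_row n (bar n A) = op_row n A.
Proof.
have [[op_row_lt _ _ cl_col_lt] [_ Ao _]] := (positions_ordered A_in, op_rowP A_in).
by symmetry; apply: (op_row_unique barA_in); rewrite ?cl_row_bar // op_col_bar bar_reflect; lia.
Qed.

Lemma left_col_bar : left_col n (bar n A) = (n.+1 - cl_col n A)%N.
Proof.
have [[_ _ _ cl_col_lt] [_ Ac _]] := (positions_ordered A_in, cl_colP A_in).
symmetry; apply: (left_col_unique barA_in); first by rewrite op_col_bar; lia.
by rewrite cl_row_bar bar_reflect //; lia.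
Qed.

Lemma cl_col_bar : cl_col n (bar n A) = (n.+1 - left_col n A)%N.
Proof.
have [[_ _ left_col_lt cl_col_lt] [_ Al _]] := (positions_ordered A_in, left_colP A_in).
symmetry; apply: (cl_col_unique barA_in); first by rewrite op_col_bar; lia.
by rewrite cl_row_bar bar_reflect //; lia.
Qed.

Lemma one_col_bar i : inr n i -> i != cl_row n A ->
  one_col n (bar n A) i = (n.+1 - one_col n A i)%N.
Proof.
move=> ni i_neq; have [nc Ai _] := one_colP A_in ni i_neq.
symmetry; apply: (one_col_unique barA_in ni); rewrite ?cl_row_bar ?bar_reflect //.
- by move: nc; rewrite /inr; lia.
- by case/andP: nc.
Qed.

Lemma is_neutral_bar : is_neutral n (bar n A) = is_neutral n A.
Proof. by rewrite /is_neutral cl_row_bar op_row_bar. Qed.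

Lemma is_negative_bar : is_negative n (bar n A) = is_positive n A.
Proof.
have [_ cl_row_le _ _] := positions_ordered A_in.
rewrite /is_negative /is_positive cl_row_bar op_row_bar op_col_bar; case: ltnP => //= row_gap.
have ni : inr n (cl_row n A).-1 by rewrite /inr; lia.
have [|nc _ _] := one_colP A_in ni; first by lia.
by rewrite one_col_bar //; [move: nc; rewrite /inr|]; lia.
Qed.

End Reflection.

Lemma bar_bar n A : mat_eq n (bar n (bar n A)) A.
Proof. by move=> i j _ /andP[_ jn]; rewrite {1}/bar bar_reflect. Qed.

Section Congruence.
Variables (n : nat) (A B : mat).
Hypotheses (A_in : in_A1 n A) (eqAB : mat_eq n A B).

Let B_in : in_A1 n B := in_A1_eq eqAB A_in.

Lemma eq_cl_row_op_col : cl_row n A = cl_row n B /\ op_col n A = op_col n B.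
Proof.
have [nr nc] := (inr_cl_row A_in, inr_op_col A_in).
by apply: (minus_one_unique B_in) => //; rewrite -eqAB //; apply: cl_row_op_col.
Qed.

Lemma eq_cl_row : cl_row n A = cl_row n B. Proof. by case: eq_cl_row_op_col. Qed.

Lemma eq_op_col : op_col n A = op_col n B. Proof. by case: eq_cl_row_op_col. Qed.

Lemma eq_one_col i : inr n i -> one_col n A i = one_col n B i.
Proof. by move=> ni; apply: eq_in_first_in => j; rewrite mem_iota1 => nj; rewrite eqAB. Qed.

Lemma eq_op_row : op_row n A = op_row n B.
Proof.
have [/andP[_ rn] nc] := (inr_cl_row A_in, inr_op_col A_in).
rewrite /op_row -eq_op_col -eq_cl_row.
by apply: eq_in_first_in => i; rewrite mem_iota => i_in; rewrite eqAB // /inr; lia.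
Qed.

Lemma eq_cl_col : cl_col n A = cl_col n B.
Proof.
have [nr /andP[_ cn]] := (inr_cl_row A_in, inr_op_col A_in).
rewrite /cl_col -eq_op_col -eq_cl_row.
by apply: eq_in_first_in => j; rewrite mem_iota => j_in; rewrite eqAB // /inr; lia.
Qed.

Lemma eq_left_col : left_col n A = left_col n B.
Proof. by rewrite /left_col eq_one_col ?eq_cl_row // inr_cl_row. Qed.

Lemma eq_is_neutral : is_neutral n A = is_neutral n B.
Proof. by rewrite /is_neutral eq_cl_row eq_op_row. Qed.

Lemma eq_is_positive : is_positive n A = is_positive n B.
Proof.
have [op_row_lt cl_row_le _ _] := positions_ordered A_in.
rewrite /is_positive -eq_cl_row -eq_op_row -eq_op_col eq_one_col // /inr; lia.
Qed.

Lemma eq_Echg : Echg n A = Echg n B.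
Proof.
have [_ cl_row_le _ _] := positions_ordered A_in.
rewrite /Echg eq_is_positive -eq_cl_row -eq_op_row -eq_op_col.
by case: ifP => // _; apply: eq_cell_sum eqAB _ _ _ _ => //; lia.
Qed.

Lemma eq_cval : cval n A = cval n B.
Proof.
have [_ _ _ cl_col_lt] := positions_ordered A_in.
rewrite /cval -eq_cl_row -eq_op_col -eq_cl_col.
by apply: eq_cell_sum eqAB _ _ _ _ => //; lia.
Qed.

End Congruence.

Section Charge.
Variables (n : nat) (A : mat).
Hypothesis A_in : in_A1 n A.

Lemma charged_cell_ge0 i j : (op_row n A < i < cl_row n A)%N -> (op_col n A < j <= n)%N ->
  0 <= A i j.
Proof.
have [_ cl_row_le _ _] := positions_ordered A_in => i_in j_in.
by apply: (entry_ge0 A_in); rewrite /inr; lia.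
Qed.

Lemma Echg_ge0 : 0 <= Echg n A.
Proof.
rewrite /Echg; case: ifP => // _.
by apply: cell_sum_ge0 => i j i_in j_in; apply: charged_cell_ge0; lia.
Qed.

Lemma Echg_gt0 : is_positive n A -> 0 < Echg n A.
Proof.
move=> /[dup] posA /andP[row_gap right_one]; rewrite /Echg posA.
have [_ cl_row_le _ _] := positions_ordered A_in.
have [||/andP[_ jn] Aij _] := @one_colP _ _ A_in (cl_row n A).-1.
- by rewrite /inr; lia.
- by lia.
apply: (@lt_le_trans _ _ (A (cl_row n A).-1 (one_col n A (cl_row n A).-1))); first by rewrite Aij.
by apply: ler_cell_sum => [i j i_in j_in||]; rewrite ?charged_cell_ge0 ?right_one //; lia.
Qed.

Lemma Echg_neutral : is_neutral n A -> Echg n A = 0.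
Proof. by rewrite /Echg /is_positive => /eqP->; rewrite ltnn. Qed.

Lemma charge_cases :
  [\/ is_negative n A /\ is_positive n A = false,
      is_negative n A = false /\ is_positive n A |
      [/\ is_negative n A = false, is_positive n A = false & is_neutral n A]].
Proof.
have [op_row_lt _ _ _] := positions_ordered A_in.
rewrite /is_negative /is_positive /is_neutral.
case: (ltnP (op_row n A).+1 (cl_row n A)) => row_gap /=; last by constructor 3; split=> //; lia.
have /(one_col_enclosed A_in) : (op_row n A < (cl_row n A).-1 < cl_row n A)%N by lia.
by case: ltngtP => // _ _; [constructor 1|constructor 2].
Qed.

End Charge.

(** * Generalized inversion tables *)

Lemma ainvE n A t : inr n t ->
  ainv n A (n.+1 - t) = cell_sum A t.+1 n 1 (one_col n A t).-1.
Proof. by case/andP=> _ tn; rewrite /ainv subKn // ltnW. Qed.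

Lemma eq_ainv n A B i : mat_eq n A B -> inr n i -> ainv n A i = ainv n B i.
Proof.
move=> eqAB ni; rewrite /ainv -(eq_one_col eqAB); last exact: inr_reflect.
apply: eq_cell_sum eqAB _ _ _ _ => //.
by apply: leq_trans (leq_pred _) (first_in_iota_leq n _).
Qed.

(* Below the 1 of row [n + 1 - i] its column sums to 0, while each of the [i - 1] rows
   below it sums to 1. *)
Lemma ainv_bar n A i : in_A1 n A -> inr n i -> (n.+1 - i)%N != cl_row n A ->
  [/\ 0 <= ainv n A i, 0 <= ainv n (bar n A) i &
      ainv n A i + ainv n (bar n A) i = i.-1%:Z].
Proof.
move=> A_in ni i_neq; have [asmA _] := A_in; set t := (n.+1 - i)%N in i_neq *.
have [nt iE] : inr n t /\ i = (n.+1 - t)%N by move: ni; rewrite /t /inr; lia.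
rewrite iE !ainvE // one_col_bar //; have [nc At _] := one_colP A_in nt i_neq.
have below0 := ASM_sum_below_one asmA nt nc At.
set c := one_col n A t in nc below0 *; move: nt nc; rewrite /inr => nt nc.
rewrite cell_sum_bar; [|by lia|by lia].
have -> : (n.+1 - (n.+1 - c).-1)%N = c.+1 by lia.
rewrite subn1 /=; split.
- by apply: (ASM_prefix_ge0 asmA); lia.
- by apply: (ASM_suffix_ge0 asmA); lia.
have := @ASM_rows_sum _ _ asmA t.+1 n; rewrite (@cell_sum_split_at c) ?below0; lia.
Qed.

Section SumsBelowClosingRow.
Variables (n : nat) (A : mat).
Hypothesis A_in : in_A1 n A.

Local Notation cr := (cl_row n A).
Local Notation cc := (cl_col n A).
Local Notation lc := (left_col n A).

Lemma below_cl_row_ge0 c1 c2 : (0 < c1)%N -> (c2 <= n)%N -> 0 <= cell_sum A cr.+1 n c1 c2.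
Proof.
move=> c1_gt0 c2n; apply: cell_sum_ge0 => i j i_in j_in.
by apply: (entry_ge0 A_in); rewrite /inr; lia.
Qed.

Lemma cval_ge0 : 0 <= cval n A.
Proof. by have [_ _ _ cl_col_lt] := positions_ordered A_in; rewrite below_cl_row_ge0 //; lia. Qed.

Lemma sum_below_left_col : cell_sum A cr.+1 n lc lc = 0.
Proof.
have [_ _ left_col_lt cl_col_lt] := positions_ordered A_in; have [_ Al _] := left_colP A_in.
by apply: (ASM_sum_below_one A_in.1 (inr_cl_row A_in) _ Al); rewrite /inr; lia.
Qed.

Lemma sum_below_cl_col : cell_sum A cr.+1 n cc cc = 0.
Proof.
have [_ _ _ cl_col_lt] := positions_ordered A_in; have [_ Ac _] := cl_colP A_in.
by apply: (ASM_sum_below_one A_in.1 (inr_cl_row A_in) _ Ac); rewrite /inr; lia.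
Qed.

End SumsBelowClosingRow.

Section NeutralTable.
Variables (n : nat) (A : mat).
Hypotheses (A_in : in_A1 n A) (neutralA : is_neutral n A).

Local Notation cr := (cl_row n A).
Local Notation oc := (op_col n A).
Local Notation lc := (left_col n A).
Local Notation k := (n.+1 - op_row n A)%N.

Lemma neutral_cl_row : cr = (op_row n A).+1. Proof. exact/eqP. Qed.

Lemma neutral_cl_rowE : cr = (n.+1 - k.-1)%N.
Proof.
have [_ cl_row_le _ _] := positions_ordered A_in.
by rewrite neutral_cl_row in cl_row_le *; lia.
Qed.

Lemma lvalE : lval n A = cell_sum A cr.+1 n lc.+1 oc.-1.
Proof.
have [_ cl_row_le left_col_lt _] := positions_ordered A_in.
have [_ Al others] := left_colP A_in.
have lead_rowE : lead_row n A = cr.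
  rewrite /lead_row -neutral_cl_row; have -> : (n - op_row n A)%N = (n - cr).+1.
    by rewrite neutral_cl_row in cl_row_le *; lia.
  by rewrite /first_in /= ifT //; apply/hasP; exists lc; rewrite ?Al // mem_iota; lia.
have lead_colE : lead_col n A = lc.
  rewrite /lead_col lead_rowE; apply: first_in_unique; rewrite ?Al ?mem_iota //; first by lia.
  by move=> j; rewrite mem_iota => j_in /eqP Aj; apply: (left_col_unique A_in) => //; lia.
rewrite /lval lead_colE -neutral_cl_row (cell_sum_split_rows (r := cr)) //.
by rewrite cell_sum_eq0 ?add0r // => i j i_in j_in; have -> : i = cr; [|apply: others]; lia.
Qed.

Lemma lval_ge0 : 0 <= lval n A.
Proof.
by have [_ _ _ cl_col_lt] := positions_ordered A_in; rewrite lvalE below_cl_row_ge0 //; lia.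
Qed.

Lemma cval_bar : cval n (bar n A) = lval n A.
Proof.
have [_ _ left_col_lt cl_col_lt] := positions_ordered A_in.
rewrite lvalE /cval cl_row_bar // op_col_bar // cl_col_bar // cell_sum_bar; [|by lia|by lia].
by congr cell_sum; lia.
Qed.

Lemma ainv_cl_row : ainv n A k.-1 = cell_sum A cr.+1 n 1 lc.-1.
Proof. by rewrite /ainv -neutral_cl_rowE. Qed.

Lemma ainv_cl_row_ge0 : 0 <= ainv n A k.-1.
Proof.
have [_ _ left_col_lt cl_col_lt] := positions_ordered A_in.
by rewrite ainv_cl_row below_cl_row_ge0 //; lia.
Qed.

Lemma sum_below_left_side : cell_sum A cr.+1 n 1 oc.-1 = ainv n A k.-1 + lval n A.
Proof.
have [_ _ left_col_lt _] := positions_ordered A_in.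
rewrite (@cell_sum_split_at lc); [|by lia|by lia].
by rewrite sum_below_left_col // ainv_cl_row lvalE addr0.
Qed.

Lemma ainv_op_row : ainv n A k = ainv n A k.-1 + lval n A + 1.
Proof.
have [op_row_lt cl_row_le _ _] := positions_ordered A_in.
have [nr nc] := (inr_cl_row A_in, inr_op_col A_in).
rewrite ainvE; last by rewrite /inr; lia.
rewrite one_col_op_row // -neutral_cl_row (cell_sum_split_rows (r := cr)) //.
have [-> _] := ASM_minus_one_row_sums A_in.1 nr nc (cl_row_op_col A_in).
by rewrite sum_below_left_side addrC.
Qed.

End NeutralTable.

Lemma eq_lval n A B : in_A1 n A -> is_neutral n A -> mat_eq n A B -> lval n A = lval n B.
Proof.
move=> A_in neutralA eqAB; have [_ _ _ cl_col_lt] := positions_ordered A_in.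
rewrite !lvalE -?(eq_is_neutral A_in eqAB) //; last exact: in_A1_eq eqAB A_in.
rewrite -(eq_cl_row A_in eqAB) -(eq_op_col A_in eqAB) -(eq_left_col A_in eqAB).
by apply: eq_cell_sum eqAB _ _ _ _; lia.
Qed.

Lemma lval_bar n A : in_A1 n A -> is_neutral n A -> lval n (bar n A) = cval n A.
Proof.
move=> A_in neutralA; have barA_in := in_A1_bar A_in.
rewrite -(eq_cval (in_A1_bar barA_in) (@bar_bar n A)) cval_bar //.
by rewrite is_neutral_bar.
Qed.

Lemma neutral_table_sum n A (k := (n.+1 - op_row n A)%N) : in_A1 n A -> is_neutral n A ->
  ainv n A k.-1 + lval n A + cval n A + ainv n (bar n A) k.-1 = k%:Z - 3.
Proof.
move=> A_in neutralA; have barA_in := in_A1_bar A_in.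
have [_ cl_row_le left_col_lt cl_col_lt] := positions_ordered A_in.
have [nr nc] := (inr_cl_row A_in, inr_op_col A_in).
have right_side : cell_sum A (cl_row n A).+1 n (op_col n A).+1 n =
    cval n A + ainv n (bar n A) k.-1.
  rewrite (@cell_sum_split_at (cl_col n A)); [|by lia|by lia].
  rewrite sum_below_cl_col // addr0 /k -(op_row_bar A_in) ainv_cl_row ?is_neutral_bar //.
  rewrite cl_row_bar // left_col_bar // cell_sum_bar; [|by lia|by lia].
  by congr (_ + cell_sum _ _ _ _ _); lia.
have := @ASM_rows_sum _ _ A_in.1 (cl_row n A).+1 n.
rewrite (@cell_sum_split_at (op_col n A)); [|by lia|by lia].
have [_ ->] := ASM_minus_one_col_sums A_in.1 nr nc (cl_row_op_col A_in).
by rewrite sum_below_left_side // right_side /k; have := neutral_cl_row neutralA; lia.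
Qed.

(** * The discharging procedure *)

Definition mat_eq_on m q (P Q : mat) : Prop :=
  forall i j, inr m i -> inr q j -> P i j = Q i j.

Lemma colnzPn m P c i : ~~ colnz m P c -> inr m i -> P i c = 0.
Proof. by move/hasPn => P0; rewrite -mem_iota1 => /P0/negPn/eqP. Qed.

Lemma eq_colnz m q P Q c : mat_eq_on m q P Q -> inr q c -> colnz m P c = colnz m Q c.
Proof. by move=> eqPQ qc; apply: eq_in_has => i; rewrite mem_iota1 => mi; rewrite eqPQ. Qed.

Lemma eq_rownz m q P Q r : mat_eq_on m q P Q -> inr m r -> rownz q P r = rownz q Q r.
Proof. by move=> eqPQ mr; apply: eq_in_has => j; rewrite mem_iota1 => qj; rewrite eqPQ. Qed.

Lemma eq_Hdisp m q P Q : mat_eq_on m q P Q -> mat_eq_on m q (Hdisp m q P) (Hdisp m q Q).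
Proof.
move=> eqPQ i j mi qj; rewrite /Hdisp (eq_colnz eqPQ qj).
have prevE : {in iota 1 j.-1, colnz m P =1 colnz m Q}.
  by move=> c; rewrite mem_iota => cj; apply: eq_colnz eqPQ _; move: qj; rewrite /inr; lia.
rewrite (eq_in_filter prevE); case: ifP => // /andP[_ prev_n0]; apply: eqPQ => //.
set prev := filter _ _ in prev_n0 *; have : last 0%N prev \in prev.
  by case: prev prev_n0 => // c s _; apply: mem_last.
by rewrite mem_filter mem_iota => /andP[_]; move: qj; rewrite /inr; lia.
Qed.

Lemma eq_Vdisp m q P Q : mat_eq_on m q P Q -> mat_eq_on m q (Vdisp m q P) (Vdisp m q Q).
Proof.
move=> eqPQ i j mi qj; rewrite /Vdisp (eq_rownz eqPQ mi).
have nextE : {in iota i.+1 (m - i), rownz q P =1 rownz q Q}.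
  by move=> r; rewrite mem_iota => ir; apply: eq_rownz eqPQ _; move: mi; rewrite /inr; lia.
rewrite (eq_in_filter nextE); case: ifP => // /andP[_ next_n0]; apply: eqPQ => //.
set next := filter _ _ in next_n0 *; have : head 0%N next \in next.
  by case: next next_n0 => // r s _; apply: mem_head.
by rewrite mem_filter mem_iota => /andP[_]; move: mi; rewrite /inr; lia.
Qed.

Lemma last_filter_iota (P : pred nat) c c' : (0 < c < c')%N -> P c ->
  (forall b, (c < b < c')%N -> ~~ P b) -> last 0%N [seq b <- iota 1 c'.-1 | P b] = c.
Proof.
move=> c_lt Pc gap; have -> : c'.-1 = (c.-1 + (1 + (c'.-1 - c)))%N by lia.
rewrite !iotaD !filter_cat /= add1n prednK; last by lia.
rewrite Pc addn1 last_cat /=; suff -> : [seq b <- iota c.+1 (c'.-1 - c) | P b] = [::] by [].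
rewrite -(filter_pred0 (iota c.+1 (c'.-1 - c))); apply: eq_in_filter => b.
by rewrite mem_iota => b_in; apply/negbTE/gap; lia.
Qed.

Section HorizontalDisplacement.
Variables (m q : nat) (P : mat).

Lemma Hdisp_next r c c' : (0 < c < c')%N -> colnz m P c -> (c' == q) || colnz m P c' ->
  (forall b, (c < b < c')%N -> ~~ colnz m P b) -> Hdisp m q P r c' = P r c.
Proof.
move=> c_lt Pc Pc' gap; rewrite /Hdisp Pc' (last_filter_iota c_lt Pc gap).
by case: eqP (last_filter_iota c_lt Pc gap) => [->|//]; case: c c_lt {Pc gap}.
Qed.

Lemma Hdisp_eq0 r c : c != q -> ~~ colnz m P c -> Hdisp m q P r c = 0.
Proof. by rewrite /Hdisp => /negbTE-> /negbTE->. Qed.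

Lemma colnz_next c : (c < q)%N -> exists2 c', (c < c' <= q)%N &
  (c' == q) || colnz m P c' /\ forall b, (c < b < c')%N -> ~~ colnz m P b.
Proof.
move=> cq; have ex : exists b, (c < b)%N && ((b == q) || colnz m P b).
  by exists q; rewrite cq eqxx.
case: (ex_minnP ex) => c' /andP[cc' Pc'] c'_min; exists c'.
  by rewrite cc' c'_min // cq eqxx.
split=> // b b_in; apply: contraL (b_in) => Pb; have := c'_min b; rewrite Pb orbT; lia.
Qed.

Lemma colnz_prev c' : (1 < c')%N -> colnz m P 1 -> exists2 c, (0 < c < c')%N &
  colnz m P c /\ forall b, (c < b < c')%N -> ~~ colnz m P b.
Proof.
move=> c'_gt1 P1; have ex : exists c, (0 < c < c')%N && colnz m P c by exists 1%N; rewrite c'_gt1.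
have bounded c : (0 < c < c')%N && colnz m P c -> (c <= c')%N by lia.
case: (ex_maxnP ex bounded) => c /andP[c_lt Pc] c_max; exists c => //.
by split=> // b b_in; apply: contraL (b_in) => Pb; have := c_max b; rewrite Pb; lia.
Qed.

Lemma colnz_Hdisp c : colnz m P 1 -> (1 < c)%N ->
  colnz m (Hdisp m q P) c = (c == q) || colnz m P c.
Proof.
move=> P1 c_gt1; have [|] := boolP (_ || _) => [Pc|]; last first.
  rewrite negb_or => /andP[cq Pc]; apply/negbTE/hasPn => r _.
  by rewrite Hdisp_eq0 ?eqxx.
have [c0 c0_lt [Pc0 gap]] := colnz_prev c_gt1 P1; rewrite -[RHS]Pc0.
by apply: eq_has => r; rewrite (Hdisp_next _ c0_lt).
Qed.

End HorizontalDisplacement.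

Lemma Hdisp_inj m q P Q :
  colnz m P 1 -> colnz m Q 1 -> ~~ colnz m P q -> ~~ colnz m Q q ->
  mat_eq_on m q (Hdisp m q P) (Hdisp m q Q) -> mat_eq_on m q P Q.
Proof.
move=> P1 Q1 Pq Qq eqH; have nzE c : inr q c -> colnz m P c = colnz m Q c.
  move=> qc; have [->|c1] := eqVneq c 1%N; first by rewrite P1 Q1.
  have [->|cq] := eqVneq c q; first by rewrite (negbTE Pq) (negbTE Qq).
  have c_gt1 : (1 < c)%N by move: qc; rewrite /inr; lia.
  have := colnz_Hdisp q P1 c_gt1; have := colnz_Hdisp q Q1 c_gt1.
  by rewrite (eq_colnz eqH qc) (negbTE cq) /= => <- <-.
move=> i j mi qj; have [Pj|Pj] := boolP (colnz m P j); last first.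
  by rewrite (colnzPn Pj mi) (colnzPn _ mi) // -nzE.
have j_neq_q : j != q by apply: contraTneq Pj => ->.
have jq : (j < q)%N by move: qj; rewrite /inr; lia.
have [c c_lt [Pc gap]] := @colnz_next m q P j jq.
have qc : inr q c by rewrite /inr; lia.
have j_lt : (0 < j < c)%N by move: qj; rewrite /inr; lia.
rewrite -(Hdisp_next i j_lt Pj Pc gap) eqH //; apply: Hdisp_next; rewrite -?nzE //.
by move=> b b_in; rewrite -nzE ?gap // /inr; lia.
Qed.

Lemma eq_replace n A B r0 c0 m q P Q : mat_eq n A B -> mat_eq_on m q P Q ->
  mat_eq n (replace A r0 c0 m q P) (replace B r0 c0 m q Q).
Proof.
move=> eqAB eqPQ i j ni nj; rewrite /replace; case: ifP => ij_in; last exact: eqAB.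
by apply: eqPQ; rewrite /inr; lia.
Qed.

Lemma eq_subm n A B r0 c0 m q : mat_eq n A B -> (0 < r0)%N -> (0 < c0)%N ->
  (r0 + m <= n.+1)%N -> (c0 + q <= n.+1)%N -> mat_eq_on m q (subm A r0 c0) (subm B r0 c0).
Proof.
by move=> eqAB ? ? ? ? i j; rewrite /inr => mi qj; apply: eqAB; rewrite /inr; lia.
Qed.

Lemma subm_replace A r0 c0 m q P : mat_eq_on m q (subm (replace A r0 c0 m q P) r0 c0) P.
Proof.
move=> i j; rewrite /inr => mi qj; rewrite /subm /replace ifT; last by lia.
by congr P; lia.
Qed.

(* The matrices obtained from [A] after the first, second and third steps of [delta]. *)
Definition erase_closing n (A : mat) : mat := fun i j =>
  if (i == cl_row n A) && ((j == op_col n A) || (j == cl_col n A)) then 0 else A i j.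

Definition displace_closing n (A : mat) : mat :=
  let m := (n - cl_row n A)%N in let q := (cl_col n A - op_col n A).+1 in
  replace (erase_closing n A) (cl_row n A).+1 (op_col n A) m q
    (Hdisp m q (subm (erase_closing n A) (cl_row n A).+1 (op_col n A))).

Definition displace_neutral n (A : mat) : mat :=
  let m := (cl_row n A - op_row n A).+1 in let q := (op_col n A).-1 in
  replace (displace_closing n A) (op_row n A) 1 m q
    (Vdisp m q (subm (displace_closing n A) (op_row n A) 1)).

Lemma deltaE n A i j : delta n A i j =
  if (j < op_col n A)%N then
    if i == op_row n A then 0
    else if (op_row n A < i <= cl_row n A)%N then displace_neutral n A i.-1 j
    else displace_neutral n A i j
  else if (op_col n A < j)%N then
    if i == (op_row n A).+1 then 0
    else if ((op_row n A).+1 < i <= cl_row n A)%N then displace_neutral n A i.-1 j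
    else displace_neutral n A i j
  else displace_neutral n A i j.
Proof. by []. Qed.

Section DeltaCongruence.
Variables (n : nat) (A B : mat).
Hypotheses (A_in : in_A1 n A) (eqAB : mat_eq n A B).

Lemma eq_erase_closing : mat_eq n (erase_closing n A) (erase_closing n B).
Proof.
move=> i j ni nj; rewrite /erase_closing (eq_cl_row A_in eqAB) (eq_op_col A_in eqAB).
by rewrite (eq_cl_col A_in eqAB) eqAB.
Qed.

Lemma eq_displace_closing : mat_eq n (displace_closing n A) (displace_closing n B).
Proof.
have [_ cl_row_le left_col_lt cl_col_lt] := positions_ordered A_in; rewrite /displace_closing /=.
rewrite -(eq_cl_row A_in eqAB) -(eq_op_col A_in eqAB) -(eq_cl_col A_in eqAB).
apply: (eq_replace _ _ eq_erase_closing); apply: eq_Hdisp.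
by apply: (eq_subm eq_erase_closing); lia.
Qed.

Lemma eq_displace_neutral : mat_eq n (displace_neutral n A) (displace_neutral n B).
Proof.
have [op_row_lt cl_row_le _ cl_col_lt] := positions_ordered A_in; rewrite /displace_neutral /=.
rewrite -(eq_cl_row A_in eqAB) -(eq_op_col A_in eqAB) -(eq_op_row A_in eqAB).
apply: (eq_replace _ _ eq_displace_closing); apply: eq_Vdisp.
by apply: (eq_subm eq_displace_closing); lia.
Qed.

Lemma eq_delta : mat_eq n (delta n A) (delta n B).
Proof.
move=> i j ni nj; rewrite !deltaE.
rewrite -(eq_cl_row A_in eqAB) -(eq_op_col A_in eqAB) -(eq_op_row A_in eqAB).
have [op_row_lt _ _ _] := positions_ordered A_in; have stepE := eq_displace_neutral ni nj.
have stepE_above : (op_row n A < i)%N ->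
    displace_neutral n A i.-1 j = displace_neutral n B i.-1 j.
  by move=> i_in; apply: eq_displace_neutral => //; move: ni; rewrite /inr; lia.
case: (j < _)%N; last case: (_ < j)%N => //.
  by case: ifP => // _; case: ifP => // i_in; apply: stepE_above; lia.
by case: ifP => // _; case: ifP => // i_in; apply: stepE_above; lia.
Qed.

End DeltaCongruence.

Definition nz_below n (A : mat) t j : bool := has (fun i => A i j != 0) (iota t.+1 (n - t)).

Lemma colnz_subm n A t c0 c : colnz (n - t) (subm A t.+1 c0) c = nz_below n A t (c + c0 - 1).
Proof.
rewrite /nz_below -[t.+1]addn1 iotaDl has_map; apply: eq_has => i /=.
by rewrite /subm addn1 addnS subn1 addnC.
Qed.

Lemma eq_nz_below n A B t j : mat_eq n A B -> inr n j -> nz_below n A t j = nz_below n B t j.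
Proof.
move=> eqAB nj; apply: eq_in_has => i; rewrite mem_iota => i_in.
by rewrite eqAB // /inr; lia.
Qed.

Lemma count_iota_inj (P : pred nat) a z z' : (a <= z)%N -> (a <= z')%N -> P z -> P z' ->
  count P (iota a (z - a)) = count P (iota a (z' - a)) -> z = z'.
Proof.
wlog lt_zz' : z z' / (z < z')%N => [symm az az' Pz Pz' countE|az az' Pz Pz'].
  by case: (ltngtP z z') => // lt; [|symmetry]; apply: symm.
have -> : (z' - a = (z - a) + (z' - z.+1).+1)%N by lia.
by rewrite iotaD count_cat /= subnKC // Pz; lia.
Qed.

Section SumsBelow.
Variables (n : nat) (A : mat).
Hypothesis A_in : in_A1 n A.

Local Notation cr := (cl_row n A).
Local Notation oc := (op_col n A).
Local Notation cc := (cl_col n A).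

Lemma sum_below_nz j : inr n j -> cell_sum A cr.+1 n j j = nz_below n A cr j.
Proof.
move=> nj.
have A_ge0 i j' : (cr < i <= n)%N -> (j <= j' <= j)%N -> 0 <= A i j'.
  by move=> i_in j_in; apply: (entry_ge0 A_in); move: nj; rewrite /inr; lia.
have [|] := boolP (nz_below n A cr j) => [/hasP[i]|/hasPn zero].
  rewrite mem_iota => i_in Aij; have := @ASM_col_suffix _ _ cr.+1 _ A_in.1 nj.
  have := @ler_cell_sum A cr.+1 n j j i j A_ge0; have := A_ge0 i j; lia.
apply: cell_sum_eq0 => i j' i_in j_in; have -> : j' = j by lia.
by apply/eqP/negPn/zero; rewrite mem_iota; lia.
Qed.

Lemma nz_below_op_col : nz_below n A cr oc.
Proof.
have [nr nc] := (inr_cl_row A_in, inr_op_col A_in); have := sum_below_nz nc.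
have [_ ->] := ASM_minus_one_col_sums A_in.1 nr nc (cl_row_op_col A_in).
by case: nz_below.
Qed.

Lemma nz_below_cl_col : nz_below n A cr cc = false.
Proof.
have [_ _ _ cl_col_lt] := positions_ordered A_in; have nc : inr n cc by rewrite /inr; lia.
by have := sum_below_nz nc; rewrite sum_below_cl_col //; case: nz_below.
Qed.

Lemma cval_count : cval n A = count (nz_below n A cr) (iota oc.+1 (cc - oc.+1)).
Proof.
have [_ _ _ cl_col_lt] := positions_ordered A_in.
rewrite /cval cell_sum_cols prednK; last by lia.
rewrite -[RHS]natz -sum1_count natr_sum [RHS]big_mkcond /=; apply: eq_big_nat => j j_in.
by rewrite sum_below_nz ?/inr; [case: nz_below|lia].
Qed.

End SumsBelow.

Section DisplacedClosingCell.
Variables (n : nat) (A : mat).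
Hypothesis A_in : in_A1 n A.

Local Notation cr := (cl_row n A).
Local Notation orow := (op_row n A).
Local Notation oc := (op_col n A).
Local Notation cc := (cl_col n A).
Local Notation closing_cell := (subm (erase_closing n A) cr.+1 oc).

Lemma erase_closing_below i j : (cr < i)%N -> erase_closing n A i j = A i j.
Proof. by rewrite /erase_closing => i_in; rewrite ifF //; lia. Qed.

Lemma displace_closing_above i j : (i <= cr)%N ->
  displace_closing n A i j = erase_closing n A i j.
Proof. by move=> i_in; rewrite /displace_closing /replace ifF //; lia. Qed.

Lemma displace_closing_op_row j : inr n j -> displace_closing n A orow j = A orow j.
Proof.
have [op_row_lt _ _ _] := positions_ordered A_in => nj.
by rewrite displace_closing_above /erase_closing ?ifF //; lia.
Qed.

Lemma op_row_zero j : inr n j -> j != oc -> A orow j = 0.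
Proof.
have [op_row_lt cl_row_le _ _] := positions_ordered A_in => nj; rewrite -(one_col_op_row A_in).
by have [||_ _] := @one_colP _ _ A_in orow; [rewrite /inr; lia|lia|apply].
Qed.

Lemma displace_closing_cl_row_left j : (0 < j < oc)%N -> displace_closing n A cr j = A cr j.
Proof.
have [_ _ _ cl_col_lt] := positions_ordered A_in => j_in.
by rewrite displace_closing_above // /erase_closing ifF //; lia.
Qed.

Lemma displace_closing_cl_row_right j : (oc < j <= n)%N -> displace_closing n A cr j = 0.
Proof.
move=> j_in; rewrite displace_closing_above // /erase_closing eqxx /=; case: ifP => // jcc.
by have [_ _ others] := cl_colP A_in; apply: others => //; lia.
Qed.

Lemma displace_closing_out i j : (cr < i)%N -> ~~ (oc <= j <= cc)%N ->
  displace_closing n A i j = A i j.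
Proof.
have [_ _ _ cl_col_lt] := positions_ordered A_in => i_in j_in.
by rewrite /displace_closing /replace ifF ?erase_closing_below //; lia.
Qed.

Lemma subm_displace_closing :
  mat_eq_on (n - cr) (cc - oc).+1 (subm (displace_closing n A) cr.+1 oc)
    (Hdisp (n - cr) (cc - oc).+1 closing_cell).
Proof. exact: subm_replace. Qed.

Lemma colnz_closing_cell c : colnz (n - cr) closing_cell c = nz_below n A cr (c + oc - 1).
Proof.
rewrite colnz_subm; apply: eq_in_has => i; rewrite mem_iota => i_in.
by rewrite erase_closing_below //; lia.
Qed.

Lemma closing_cell_first : colnz (n - cr) closing_cell 1.
Proof. by rewrite colnz_closing_cell addKn nz_below_op_col. Qed.

Lemma closing_cell_last : ~~ colnz (n - cr) closing_cell (cc - oc).+1.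
Proof.
have [_ _ _ cl_col_lt] := positions_ordered A_in; rewrite colnz_closing_cell.
by have -> : ((cc - oc).+1 + oc - 1)%N = cc by [lia]; rewrite nz_below_cl_col.
Qed.

Lemma nz_below_displace_closing j : (oc < j <= cc)%N ->
  nz_below n (displace_closing n A) cr j = (j == cc) || nz_below n A cr j.
Proof.
move=> j_in; have jE : j = ((j - oc).+1 + oc - 1)%N by lia.
rewrite [in LHS]jE -colnz_subm (eq_colnz subm_displace_closing); last by rewrite /inr; lia.
rewrite colnz_Hdisp ?closing_cell_first //; last by lia.
by rewrite colnz_closing_cell -jE; congr orb; lia.
Qed.

Lemma cval_displace_closing :
  cval n A = count (nz_below n (displace_closing n A) cr) (iota oc.+1 (cc - oc.+1)).
Proof.
rewrite cval_count //; congr Posz; apply: eq_in_count => j; rewrite mem_iota => j_in.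
by rewrite nz_below_displace_closing; [case: eqP|]; lia.
Qed.

End DisplacedClosingCell.

Section NeutralDelta.
Variables (n : nat) (A : mat).
Hypotheses (A_in : in_A1 n A) (neutralA : is_neutral n A).

Local Notation cr := (cl_row n A).
Local Notation oc := (op_col n A).
Local Notation orow := (op_row n A).
Local Notation D := (displace_closing n A).

(* Only the closing row of the extended neutral cell is nonzero, so [V] raises it by one row. *)
Lemma displace_neutral_op_row j : (0 < j < oc)%N -> displace_neutral n A orow j = D cr j.
Proof.
have [[_ _ left_col_lt _] [_ Al _]] := (positions_ordered A_in, left_colP A_in) => j_in.
have subm2 c : (0 < c)%N -> subm D orow 1 2 c = D cr c.
  by rewrite /subm addnK neutral_cl_row // => _; congr D; lia.
rewrite /displace_neutral /replace ifT; last by lia.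
rewrite subnn neutral_cl_row // subSnn subnK ?[RHS]/=; last by lia.
have row2_nz : rownz oc.-1 (subm D orow 1) 2.
  apply/hasP; exists (left_col n A); first by rewrite mem_iota; lia.
  by rewrite subm2 ?displace_closing_cl_row_left ?Al //; lia.
by rewrite /Vdisp /= row2_nz /= subm2 -?neutral_cl_row //; lia.
Qed.

Lemma displace_neutral_out i j : (i < orow)%N || (cr < i)%N || (oc <= j)%N ->
  displace_neutral n A i j = D i j.
Proof.
move=> ij_in; rewrite /displace_neutral /replace ifF //.
by have := neutral_cl_row neutralA; lia.
Qed.

(* On a neutral matrix the last two steps of [delta] undo each other. *)
Lemma delta_neutral : mat_eq n (delta n A) D.
Proof.
have crE := neutral_cl_row neutralA; move=> i j ni nj; rewrite deltaE; case: ltngtP => j_in.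
- case: eqP => [->|/eqP io]; first by rewrite displace_closing_op_row // op_row_zero //; lia.
  case: ifP => i_in; last by apply: displace_neutral_out; lia.
  have -> : i = cr by lia.
  by rewrite crE /= displace_neutral_op_row -?crE //; move: nj; rewrite /inr; lia.
- case: eqP => [->|/eqP ir].
    by rewrite -crE displace_closing_cl_row_right //; move: nj; rewrite /inr; lia.
  by rewrite ifF; [apply: displace_neutral_out|]; lia.
- by apply: displace_neutral_out; lia.
Qed.

Lemma one_col_delta : one_col n (delta n A) orow = oc.
Proof.
have [op_row_lt cl_row_le _ _] := positions_ordered A_in; rewrite -[RHS](one_col_op_row A_in).
apply: eq_in_first_in => j; rewrite mem_iota1 => nj.
by rewrite delta_neutral ?displace_closing_op_row // /inr; lia.
Qed.

End NeutralDelta.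

Section DeltaInjective.
Variables (n : nat) (A B : mat).
Hypotheses (A_in : in_A1 n A) (neutralA : is_neutral n A).
Hypotheses (B_in : in_A1 n B) (neutralB : is_neutral n B).
Hypotheses (eq_row : op_row n A = op_row n B) (eq_del : mat_eq n (delta n A) (delta n B)).

Lemma delta_inj_cl_row : cl_row n A = cl_row n B.
Proof. by rewrite !neutral_cl_row ?eq_row. Qed.

Lemma delta_inj_op_col : op_col n A = op_col n B.
Proof.
rewrite -one_col_delta // -(one_col_delta B_in) // -eq_row; apply: eq_one_col => //.
by have [op_row_lt cl_row_le _ _] := positions_ordered A_in; rewrite /inr; lia.
Qed.

Lemma delta_inj_displace_closing : mat_eq n (displace_closing n A) (displace_closing n B).
Proof. by move=> i j ni nj; rewrite -!delta_neutral ?eq_del. Qed.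

Hypothesis eq_c : cval n A = cval n B.

Lemma delta_inj_cl_col : cl_col n A = cl_col n B.
Proof.
have [[_ _ _ cl_col_lt] [_ _ _ cl_col_lt']] := (positions_ordered A_in, positions_ordered B_in).
apply: (@count_iota_inj (nz_below n (displace_closing n A) (cl_row n A)) (op_col n A).+1).
- by lia.
- by rewrite delta_inj_op_col; lia.
- by rewrite nz_below_displace_closing ?eqxx //; lia.
- rewrite (eq_nz_below _ delta_inj_displace_closing); last by rewrite /inr; lia.
  by rewrite delta_inj_cl_row nz_below_displace_closing ?eqxx //; lia.
apply/eqP; rewrite -eqz_nat -cval_displace_closing // eq_c cval_displace_closing // eqz_nat.
rewrite -delta_inj_op_col -delta_inj_cl_row; apply/eqP/eq_in_count => j; rewrite mem_iota => j_in.
rewrite (eq_nz_below _ delta_inj_displace_closing) // /inr; lia.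
Qed.

Lemma delta_inj_below i j : (cl_row n A < i <= n)%N -> inr n j -> A i j = B i j.
Proof.
move=> i_in nj; have [_ _ left_col_lt cl_col_lt] := positions_ordered A_in.
have eqD := delta_inj_displace_closing.
have ni : inr n i by rewrite /inr; lia.
have [j_in|out] := boolP (op_col n A <= j <= cl_col n A)%N; last first.
  rewrite -[LHS](displace_closing_out A_in) -?[RHS](displace_closing_out B_in) ?eqD //; try lia.
    by rewrite -delta_inj_cl_row; lia.
  by rewrite -delta_inj_op_col -delta_inj_cl_col.
set m := (n - cl_row n A)%N; set q := (cl_col n A - op_col n A).+1.
pose cell C := subm (erase_closing n C) (cl_row n C).+1 (op_col n C).
have cellE : mat_eq_on m q (cell A) (cell B).
  have eqsub : mat_eq_on m q (subm (displace_closing n A) (cl_row n A).+1 (op_col n A))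
                 (subm (displace_closing n B) (cl_row n A).+1 (op_col n A)).
    by apply: eq_subm eqD _ _ _ _; rewrite /m /q; lia.
  apply: Hdisp_inj; rewrite ?closing_cell_first ?closing_cell_last //.
  - by rewrite /m delta_inj_cl_row closing_cell_first.
  - by rewrite /m /q delta_inj_cl_row delta_inj_op_col delta_inj_cl_col closing_cell_last.
  move=> i' j' mi qj; rewrite -subm_displace_closing // eqsub //; move: mi qj.
  rewrite /m /q delta_inj_cl_row delta_inj_op_col delta_inj_cl_col => mi qj.
  exact: subm_displace_closing.
have := cellE (i - cl_row n A)%N (j - op_col n A).+1.
rewrite /cell /subm -delta_inj_cl_row -delta_inj_op_col.
have -> : (i - cl_row n A + (cl_row n A).+1 - 1)%N = i by lia.
have -> : ((j - op_col n A).+1 + op_col n A - 1)%N = j by lia.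
by rewrite !erase_closing_below -?delta_inj_cl_row; try lia; apply; rewrite /inr /m /q; lia.
Qed.

Lemma delta_neutral_inj : mat_eq n A B.
Proof.
move=> i j ni nj; have [i_in|i_in] := leqP i (cl_row n A); last first.
  by apply: delta_inj_below => //; move: ni; rewrite /inr; lia.
have := delta_inj_displace_closing ni nj; rewrite !displace_closing_above -?delta_inj_cl_row //.
rewrite /erase_closing -delta_inj_cl_row -delta_inj_op_col -delta_inj_cl_col.
case: ifP => // /andP[/eqP-> /orP[]/eqP-> _].
  by rewrite [in RHS]delta_inj_cl_row [in RHS]delta_inj_op_col !cl_row_op_col.
have [[_ -> _] [_ Bc _]] := (cl_colP A_in, cl_colP B_in).
by rewrite delta_inj_cl_row delta_inj_cl_col Bc.
Qed.

End DeltaInjective.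

(** * Lattice words *)

Lemma endpt_cat p u v : endpt p (u ++ v) = endpt (endpt p u) v.
Proof. exact: foldl_cat. Qed.

Lemma endpt_nseq (p : pt) m s : s \notin [:: sS; sN] -> endpt p (nseq m s) = (p.1 + m%:Z, p.2).
Proof.
move=> horizontal; elim: m p => [|m IHm] p /=; first by rewrite addr0; case: p.
by rewrite /endpt /= -/(endpt _ _) IHm; case: s horizontal {IHm} => //= _; congr pair; lia.
Qed.

Lemma mem_verts_cat (p : pt) (u v : seq step) (q : pt) :
  q \in verts p (u ++ v) -> q \in verts p u \/ q \in verts (endpt p u) v.
Proof.
rewrite /verts; elim: u p => [|s u IHu] p /=; first by right.
rewrite in_cons => /orP[/eqP->|/IHu[qu|qv]]; [left|left|by right].
  exact: mem_head.
by rewrite in_cons qu orbT.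
Qed.

Lemma mem_verts_nseq (p : pt) m s (q : pt) : s \notin [:: sS; sN] ->
  q \in verts p (nseq m s) -> q.2 = p.2 /\ p.1 <= q.1 <= p.1 + m%:Z.
Proof.
move=> horizontal; elim: m p => [|m IHm] p.
  by rewrite /verts /= inE => /eqP->; split=> //; lia.
rewrite /verts /= in_cons => /orP[/eqP->|]; first by split=> //; lia.
by case: s horizontal IHm => //= _ IHm /IHm /= [-> q_in]; split=> //; lia.
Qed.

Lemma mem_verts_LR p w q : q \in verts p w -> q \in Lverts p w \/ q \in Rverts p w.
Proof. by rewrite -{1}(cat_take_drop (find (fun s => ~~ isL s) w) w) => /mem_verts_cat. Qed.

Lemma endpt_junction p w : endpt p w = endpt (junction p w) (rpart w).
Proof. by rewrite -endpt_cat cat_take_drop. Qed.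

Lemma nth_verts q p w t : (t <= size w)%N -> nth q (verts p w) t = endpt p (take t w).
Proof.
rewrite /verts; elim: w p t => [|s w IHw] p [|t] //= tw; exact: IHw.
Qed.

Lemma lrpart_cat u v : all isL u -> all isR v -> lpart (u ++ v) = u /\ rpart (u ++ v) = v.
Proof.
move=> Lu Rv; rewrite /lpart /rpart.
suff -> : find (fun s => ~~ isL s) (u ++ v) = size u by rewrite take_size_cat // drop_size_cat.
rewrite find_cat; have /negbTE-> : ~~ has (fun s => ~~ isL s) u by rewrite has_predC negbK.
by case: v Rv => [|[]] //=; rewrite addn0.
Qed.

Lemma notin_nseq (T : eqType) (s t : T) m : s != t -> s \notin nseq m t.
Proof. by move=> st; rewrite mem_nseq negb_and st orbT. Qed.

Definition single_letter n (Om : seq (seq step)) (s : step) (i : nat) (u v : seq step) : Prop :=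
  [/\ inr n i, path_of Om i = u ++ s :: v, s \notin u ++ v &
      forall j, inr n j -> j != i -> s \notin path_of Om j].

Lemma single_letter_position n Om s i u v j t : single_letter n Om s i u v -> inr n j ->
  (t < size (path_of Om j))%N -> nth sE (path_of Om j) t = s -> j = i /\ t = size u.
Proof.
case=> ni pathE; rewrite mem_cat negb_or => /andP[su sv] others nj lt_t nth_t.
have jE : j = i by apply/eqP; apply: contraT => /(others j nj); rewrite -nth_t mem_nth.
split=> //; move: lt_t nth_t; rewrite jE pathE size_cat /= nth_cat => lt_t.
have [lt_tu nth_t|] := ltnP t (size u); first by rewrite -nth_t mem_nth in su.
rewrite leq_eqVlt => /orP[/eqP //|lt_ut].
rewrite -(subnSK lt_ut) /= => nth_t; rewrite -nth_t mem_nth // in sv.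
by rewrite ltn_subLR // addSnnS.
Qed.

Lemma S_starts_single n Om i u v p : single_letter n Om sS i u v ->
  S_starts n Om p <-> p = endpt (startp i) u.
Proof.
move=> single; have [ni pathE _ _] := single; split.
  case=> j nj [t lt_t [nth_t ->]]; have [-> ->] := single_letter_position single nj lt_t nth_t.
  by rewrite pathE nth_verts ?take_size_cat // size_cat leq_addr.
move=> ->; exists i => //; exists (size u); rewrite pathE.
  by rewrite size_cat /= addnS ltnS leq_addr.
by rewrite nth_cat ltnn subnn nth_verts ?take_size_cat // size_cat leq_addr.
Qed.

Lemma N_ends_single n Om i u v p : single_letter n Om sN i u v ->
  N_ends n Om p <-> p = endpt (startp i) (rcons u sN).
Proof.
move=> single; have [ni pathE _ _] := single; split.
  case=> j nj [t lt_t [nth_t ->]]; have [-> ->] := single_letter_position single nj lt_t nth_t.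
  rewrite pathE -cat_rcons nth_verts ?take_size_cat ?size_rcons //.
  by rewrite size_cat size_rcons leq_addr.
move=> ->; exists i => //; exists (size u); rewrite pathE.
  by rewrite size_cat /= addnS ltnS leq_addr.
rewrite nth_cat ltnn subnn nth_verts -?cat_rcons ?take_size_cat ?size_rcons //.
by rewrite size_cat size_rcons leq_addr.
Qed.

(** * Mixed configurations with one N-step *)

Section Configuration.
Variables (n k : nat) (a : nat -> nat) (b beta : nat).

Definition left_word (i : nat) : seq step :=
  if i == k then nseq (a i) sE ++ sS :: nseq b sE else nseq (a i) sE.

Definition right_word (i : nat) : seq step :=
  if i == k.-1 then nseq beta sF ++ sN :: nseq (k - 2 - a i - beta) sF
  else if i == k then nseq (k - 2 - a i - b) sF else nseq (i - 1 - a i) sF.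

Definition config : seq (seq step) := [seq left_word i ++ right_word i | i <- iota 1 n].

Definition config_junction (i : nat) : pt :=
  if i == k then (Posz (a k + b), Posz k - 1) else (Posz (a i), Posz i).

Definition swap_ends (i : nat) : nat :=
  if i == k then k.-1 else if i == k.-1 then k else i.

Definition valid_table : Prop :=
  [/\ (1 < k <= n)%N, forall i, inr n i -> i != k.-1 -> (a i < i)%N,
      (a k + b + 2 <= k)%N, (a k.-1 < a k)%N & (a k.-1 + beta < a k + b)%N].

Lemma path_of_config i : inr n i -> path_of config i = left_word i ++ right_word i.
Proof.
case/andP=> i_gt0 le_in; rewrite /path_of (nth_map 0%N) ?size_iota; last by lia.
by rewrite nth_iota; last lia; rewrite add1n prednK.
Qed.

Lemma all_isR_right_word i : all isR (right_word i).
Proof. by rewrite /right_word; do 2?case: ifP => _; rewrite ?all_cat /= !all_nseq ?orbT. Qed.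

Lemma lrpart_config i : inr n i ->
  lpart (path_of config i) = left_word i /\ rpart (path_of config i) = right_word i.
Proof.
move=> ni; rewrite path_of_config //; apply: lrpart_cat (all_isR_right_word i).
by rewrite /left_word; case: ifP => _; rewrite ?all_cat /= !all_nseq ?orbT.
Qed.

Lemma lpart_config i : inr n i -> lpart (path_of config i) = left_word i.
Proof. by case/lrpart_config. Qed.

Lemma rpart_config i : inr n i -> rpart (path_of config i) = right_word i.
Proof. by case/lrpart_config. Qed.

Lemma junction_config i : inr n i -> junction (startp i) (path_of config i) = config_junction i.
Proof.
move=> ni; rewrite /junction lpart_config // /left_word /config_junction.
case: eqP => [->|_]; last by rewrite endpt_nseq // /startp /= add0r.
by rewrite endpt_cat endpt_nseq //= /endpt /= -/(endpt _ _) endpt_nseq.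
Qed.

Lemma junctions_config p :
  junctions n config p <-> exists2 i, inr n i & p = config_junction i.
Proof. by split=> -[i ni ->]; exists i => //; rewrite junction_config. Qed.

Lemma swap_ends_inr i : (1 < k <= n)%N -> inr n i -> inr n (swap_ends i).
Proof. by rewrite /swap_ends /inr => k_in ni; do 2?case: eqP; lia. Qed.

Lemma swap_endsK : (0 < k)%N -> involutive swap_ends.
Proof. by move=> k_gt0 i; rewrite /swap_ends; do 4?case: eqP; lia. Qed.

Lemma mem_Lverts_config i (q : pt) : inr n i ->
  q \in Lverts (startp i) (path_of config i) ->
  (q.2 = Posz i /\ 0 <= q.1 <= Posz (a i)) \/
  [/\ i = k, q.2 = Posz k - 1 & Posz (a k) <= q.1 <= Posz (a k + b)].
Proof.
move=> ni; rewrite /Lverts lpart_config // /left_word.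
case: eqP => [->|_]; last by move/(@mem_verts_nseq _ _ sE _ isT)=> /= ?; left.
case/mem_verts_cat; first by move/(@mem_verts_nseq _ _ sE _ isT)=> /= ?; left.
rewrite endpt_nseq //= /verts /= in_cons => /orP[/eqP->|]; first by left; split=> //=; lia.
by move/(@mem_verts_nseq _ _ sE _ isT)=> /= [? ?]; right; split=> //; lia.
Qed.

Hypothesis valid : valid_table.

Lemma mem_Rverts_config i (q : pt) : inr n i ->
  q \in Rverts (startp i) (path_of config i) ->
  [\/ [/\ i != k, i != k.-1, q.2 = Posz i & Posz (a i) <= q.1 < Posz i],
      [/\ i = k.-1, q.2 = Posz k - 1 & Posz (a i) <= q.1 <= Posz (a i + beta)],
      [/\ i = k.-1, q.2 = Posz k & Posz (a i + beta + 1) <= q.1 < Posz k] |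
      [/\ i = k, q.2 = Posz k - 1 & Posz (a k + b) <= q.1 < Posz k - 1]].
Proof.
have [_ a_lt b_le _ beta_lt] := valid => ni.
rewrite /Rverts rpart_config // junction_config // /right_word /config_junction.
have [iE|ik'] := eqVneq i k.-1.
  have -> : (i == k) = false by lia.
  case/mem_verts_cat => [/(@mem_verts_nseq _ _ sF _ isT) /= [? ?]|].
    by constructor 2; split=> //; lia.
  rewrite endpt_nseq //= /verts /= in_cons => /orP[/eqP->|].
    by constructor 2; split=> //=; lia.
  move/(@mem_verts_nseq _ _ sF _ isT) => /= [? ?]; subst i.
  by constructor 3; split=> //; lia.
have [->|ik] := eqVneq i k => /(@mem_verts_nseq _ _ sF _ isT) /= [? ?].
  by constructor 4; split=> //; lia.
by have ? := a_lt i ni ik'; constructor 1; split=> //; lia.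
Qed.

Lemma config_inG i : inr n i -> all (inG n) (verts (startp i) (path_of config i)).
Proof.
have [k_in a_lt b_le _ beta_lt] := valid => ni; apply/allP => q.
have a_lt_i : (a i < i)%N by have [->|/(a_lt i ni)//] := eqVneq i k.-1; lia.
case/mem_verts_LR => [/(mem_Lverts_config ni)|/(mem_Rverts_config ni)].
  by move: ni; rewrite /inG /inr => ni [[]|[]]; lia.
by move: ni; rewrite /inG /inr => ni [] [] *; subst; lia.
Qed.

Lemma endpt_config i : inr n i ->
  endpt (startp i) (path_of config i) = (Posz (swap_ends i) - 1, Posz (swap_ends i)).
Proof.
have [_ a_lt b_le _ beta_lt] := valid => ni.
rewrite endpt_junction junction_config // rpart_config // /config_junction /right_word /swap_ends.
have [->|ik] := eqVneq i k.
  have -> : (k == k.-1) = false by lia.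
  by rewrite endpt_nseq //=; congr pair; lia.
have [->|ik'] := eqVneq i k.-1; last first.
  by have ? := a_lt i ni ik'; rewrite endpt_nseq //=; congr pair; lia.
by rewrite endpt_cat endpt_nseq //= /endpt /= -/(endpt _ _) endpt_nseq //=; congr pair; lia.
Qed.

Lemma config_disjoint i j : inr n i -> inr n j -> i != j ->
  disj (Lverts (startp i) (path_of config i)) (Lverts (startp j) (path_of config j))
  && disj (Rverts (startp i) (path_of config i)) (Rverts (startp j) (path_of config j)).
Proof.
have [_ _ _ a_lt_k beta_lt] := valid => ni nj ij; apply/andP; split; apply/allP => q.
  move=> /(mem_Lverts_config ni) qi; apply/negP => /(mem_Lverts_config nj) qj.
  case: qi => [[? ?]|[? ? ?]]; case: qj => [[? ?]|[? ? ?]]; try lia.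
    have ? : i = k.-1 by lia.
    by subst; lia.
  have ? : j = k.-1 by lia.
  by subst; lia.
move=> /(mem_Rverts_config ni) qi; apply/negP => /(mem_Rverts_config nj) qj.
by case: qi => -[] *; case: qj => -[] *; subst; lia.
Qed.

Lemma single_S_config :
  single_letter n config sS k (nseq (a k) sE) (nseq b sE ++ right_word k).
Proof.
have [k_in _ _ _ _] := valid; have nk : inr n k by rewrite /inr; lia.
split=> //; first by rewrite path_of_config // /left_word eqxx -catA.
  rewrite !mem_cat !negb_or !notin_nseq // /right_word eqxx.
  by case: ifP; rewrite ?mem_cat ?in_cons ?negb_or ?notin_nseq.
move=> i ni ik; rewrite path_of_config // /left_word /right_word (negbTE ik).
by case: ifP => _; rewrite !mem_cat ?in_cons !negb_or ?notin_nseq.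
Qed.

Lemma single_N_config :
  single_letter n config sN k.-1 (nseq (a k.-1) sE ++ nseq beta sF)
    (nseq (k - 2 - a k.-1 - beta) sF).
Proof.
have [k_in _ _ _ _] := valid; have nk : inr n k.-1 by rewrite /inr; lia.
split=> //.
- rewrite path_of_config // /left_word /right_word eqxx -catA.
  by have -> : (k.-1 == k) = false by lia.
- by rewrite !mem_cat !negb_or !notin_nseq.
move=> i ni ik; rewrite path_of_config // /left_word /right_word (negbTE ik).
by case: ifP => _; rewrite !mem_cat ?in_cons !negb_or ?notin_nseq.
Qed.

Lemma S_starts_config p : S_starts n config p <-> p = (Posz (a k), Posz k).
Proof. by rewrite (S_starts_single _ single_S_config) endpt_nseq //= add0r. Qed.

Lemma N_ends_config p : N_ends n config p <-> p = (Posz (a k.-1 + beta + 1), Posz k).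
Proof.
have [k_in _ _ _ _] := valid.
rewrite (N_ends_single _ single_N_config) -cats1 !endpt_cat !endpt_nseq //= /endpt /=.
have -> : (0 + Posz (a k.-1) + Posz beta + 1, Posz k.-1 + 1) =
          (Posz (a k.-1 + beta + 1), Posz k) :> pt by congr pair; lia.
by [].
Qed.

Lemma count_N_config : (\sum_(i <- iota 1 n) count (pred1 sN) (path_of config i))%N = 1%N.
Proof.
have [nk pathE N_notin others] := single_N_config.
rewrite (bigD1_seq k.-1) ?iota_uniq ?mem_iota1 //= pathE !count_cat /= !count_nseq /= !mul0n.
rewrite big1_seq // => i /andP[ik]; rewrite mem_iota1 => ni.
exact/count_memPn/others.
Qed.

Lemma config_M1 : in_M1 n config.
Proof.
have [k_in _ _ _ _] := valid; split.
- by rewrite size_map size_iota.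
- by move=> i ni; rewrite /wf_word rpart_config // all_isR_right_word config_inG.
- exists swap_ends; split=> [i|i j ni nj|i]; [exact: swap_ends_inr| |exact: endpt_config].
  by apply: (inv_inj (swap_endsK _)); lia.
- exact: config_disjoint.
- exact: count_N_config.
Qed.

End Configuration.

Lemma rhoK : involutive rho.
Proof. by case=> x y; rewrite /rho /=; congr pair; lia. Qed.

Lemma rho_image (P Q : pt -> Prop) :
  (forall p, P p -> Q (rho p)) -> (forall q, Q q -> P (rho q)) ->
  forall q, Q q <-> exists2 p, P p & q = rho p.
Proof.
move=> PQ QP q; split=> [/QP Prq|[p Pp ->]]; last exact: PQ.
by exists (rho q); rewrite ?rhoK.
Qed.

Definition dual_tables n k a b beta a' b' beta' : Prop :=
  [/\ forall i, inr n i -> i != k.-1 -> (a i + a' i = i.-1)%N,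
      (a' k.-1 + a k + b = k - 2)%N, (b' + a k.-1 + 1 = a k)%N &
      (beta' + a k.-1 + beta + 1 = a k + b)%N].

Section DualTables.
Variables (n k : nat) (a a' : nat -> nat) (b b' beta beta' : nat).
Hypothesis dual : dual_tables n k a b beta a' b' beta'.

Lemma dual_tables_k : (1 < k <= n)%N -> (a k + a' k = k.-1)%N.
Proof. by have [aE _ _ _] := dual => k_in; apply: aE; rewrite /inr; lia. Qed.

Lemma dual_tables_sym : (1 < k <= n)%N -> dual_tables n k a' b' beta' a b beta.
Proof.
move=> k_in; have a_kE := dual_tables_k k_in; have [aE ? ? ?] := dual.
by split=> [i ni ik|||]; [rewrite addnC aE|lia|lia|lia].
Qed.

Lemma valid_table_dual : valid_table n k a b beta -> valid_table n k a' b' beta'.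
Proof.
case=> k_in _ ? ? ?; have a_kE := dual_tables_k k_in; have [aE ? ? ?] := dual.
split=> //; try lia.
by move=> i ni ik; have := aE i ni ik; move: ni; rewrite /inr; lia.
Qed.

Lemma rho_config_junction i : (1 < k <= n)%N -> inr n i ->
  rho (config_junction k a b i) = config_junction k a' b' (swap_ends k i).
Proof.
move=> k_in ni; have a_kE := dual_tables_k k_in; have [aE ? ? ?] := dual.
rewrite /config_junction /swap_ends /rho; have [_|ik] := eqVneq i k.
  by have -> : (k.-1 == k) = false by [lia]; congr pair => /=; lia.
have [iE|ik'] := eqVneq i k.-1; first by rewrite eqxx /= iE; congr pair; lia.
by have := aE i ni ik'; move: ni; rewrite /inr (negbTE ik) /= => ? ?; congr pair; lia.
Qed.

End DualTables.

Lemma config_dual n k a b beta a' b' beta' :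
  valid_table n k a b beta -> dual_tables n k a b beta a' b' beta' ->
  is_dual n (config n k a b beta) (config n k a' b' beta').
Proof.
move=> valid dual; have valid' := valid_table_dual dual valid.
have [k_in _ _ _ _] := valid; have dual' := dual_tables_sym dual k_in.
have a_kE := dual_tables_k dual k_in; have [_ abE b'E betaE] := dual.
split; [exact: config_M1|exact: config_M1|apply: rho_image..] => p.
- rewrite !junctions_config => -[i ni ->]; exists (swap_ends k i); first exact: swap_ends_inr.
  exact: rho_config_junction dual _ _ _.
- rewrite !junctions_config => -[i ni ->]; exists (swap_ends k i); first exact: swap_ends_inr.
  exact: rho_config_junction dual' _ _ _.
- by rewrite !S_starts_config // => ->; rewrite /rho /=; congr pair; lia.
- by rewrite !S_starts_config // => ->; rewrite /rho /=; congr pair; lia.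
- by rewrite !N_ends_config // => ->; rewrite /rho /=; congr pair; lia.
- by rewrite !N_ends_config // => ->; rewrite /rho /=; congr pair; lia.
Qed.

(** * Duality *)

Definition in_N1 n (N : mat) (E : int) : Prop :=
  [/\ in_A1 n N, is_neutral n N & - lval n N <= E <= cval n N].

Lemma in_N1_eq n A B E : mat_eq n A B -> in_N1 n A E -> in_N1 n B E.
Proof.
move=> eqAB [A_in neutralA E_in]; split; first exact: in_A1_eq eqAB A_in.
  by rewrite -(eq_is_neutral A_in eqAB).
by rewrite -(eq_lval A_in neutralA eqAB) -(eq_cval A_in eqAB).
Qed.

Lemma in_N1_bar n N E : in_N1 n N E -> in_N1 n (bar n N) (- E).
Proof.
case=> N_in neutralN E_in; split; [exact: in_A1_bar|by rewrite is_neutral_bar|].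
by rewrite lval_bar ?cval_bar //; lia.
Qed.

Lemma eq_Phi n A B E : mat_eq n A B -> in_N1 n A E -> Phi n A E = Phi n B E.
Proof.
move=> eqAB [A_in neutralA _]; rewrite /Phi -(eq_op_row A_in eqAB) -(eq_cval A_in eqAB).
rewrite -(eq_lval A_in neutralA eqAB); apply/eq_in_map => i; rewrite mem_iota1 => ni.
by rewrite (eq_ainv eqAB).
Qed.

Lemma PhiE n A E : (op_row n A <= n)%N ->
  Phi n A E = config n (n.+1 - op_row n A) (fun i => tn (ainv n A i))
                (tn (cval n A)) (tn (E + lval n A)).
Proof.
move=> le_on; rewrite /Phi /config; apply: eq_map => i; rewrite /left_word /right_word.
case: (i =P (n.+1 - op_row n A).-1) => [iE|_]; last by case: ifP => // _; rewrite -catA.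
by rewrite ifF //; lia.
Qed.

Lemma tn_max z : tn z = `|Num.max z 0|%N.
Proof. by case: z. Qed.

Section NeutralPair.
Variables (n : nat) (N : mat) (E : int).
Hypothesis NE_in : in_N1 n N E.

Local Notation k := (n.+1 - op_row n N)%N.

Lemma ainv_sum i : inr n i -> i != k.-1 ->
  [/\ 0 <= ainv n N i, 0 <= ainv n (bar n N) i & ainv n N i + ainv n (bar n N) i = i.-1%:Z].
Proof.
have [N_in neutralN _] := NE_in => ni ik; apply: ainv_bar => //; rewrite neutral_cl_row //.
by move: ni ik; rewrite /inr; lia.
Qed.

Lemma ainv_ends :
  [/\ 0 <= ainv n N k.-1, 0 <= ainv n (bar n N) k.-1,
      ainv n N k = ainv n N k.-1 + lval n N + 1 &
      ainv n N k.-1 + lval n N + cval n N + ainv n (bar n N) k.-1 = k%:Z - 3].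
Proof.
have [N_in neutralN _] := NE_in; split.
- exact: ainv_cl_row_ge0.
- rewrite -(op_row_bar N_in); apply: ainv_cl_row_ge0; first exact: in_A1_bar.
  by rewrite is_neutral_bar.
- exact: ainv_op_row.
- exact: neutral_table_sum.
Qed.

Lemma neutral_valid_table :
  valid_table n k (fun i => tn (ainv n N i)) (tn (cval n N)) (tn (E + lval n N)).
Proof.
have [N_in neutralN E_in] := NE_in; have [op_row_lt _ _ _] := positions_ordered N_in.
have [? ? aE sumE] := ainv_ends; have ? := lval_ge0 N_in neutralN; have ? := cval_ge0 N_in.
have crE := neutral_cl_row neutralN; split; rewrite ?tn_max ?aE; try lia.
by move=> i ni ik; have [? ? ?] := ainv_sum ni ik; rewrite tn_max; move: ni; rewrite /inr; lia.
Qed.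

Lemma neutral_dual_tables :
  dual_tables n k (fun i => tn (ainv n N i)) (tn (cval n N)) (tn (E + lval n N))
    (fun i => tn (ainv n (bar n N) i)) (tn (cval n (bar n N))) (tn (- E + lval n (bar n N))).
Proof.
have [N_in neutralN E_in] := NE_in; rewrite cval_bar // lval_bar //.
have [? ? aE sumE] := ainv_ends; have ? := lval_ge0 N_in neutralN; have ? := cval_ge0 N_in.
split; rewrite ?tn_max ?aE; try lia.
by move=> i ni ik; have [? ? ?] := ainv_sum ni ik; rewrite !tn_max; lia.
Qed.

End NeutralPair.

Lemma Phi_dual n N E : in_N1 n N E -> is_dual n (Phi n N E) (Phi n (bar n N) (- E)).
Proof.
move=> NE_in; have [N_in _ _] := NE_in; have [op_row_lt cl_row_le _ _] := positions_ordered N_in.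
rewrite !PhiE ?op_row_bar //; try lia.
exact: config_dual (neutral_valid_table NE_in) (neutral_dual_tables NE_in).
Qed.

(** * The neutralizing procedure *)

Lemma Lambda_PN_neutral n A N E : Lambda_PN n A N E -> in_A1 n N /\ is_neutral n N.
Proof.
case=> -[N_in /orP[posN|//]] [_ [_ [_ [_ EN0]]]].
by have := Echg_gt0 N_in posN; rewrite EN0.
Qed.

Lemma Lambda_PN_unique n A N M E F : Lambda_PN n A N E -> Lambda_PN n A M F ->
  mat_eq n N M /\ E = F.
Proof.
move=> lamN lamM; have [N_in neutralN] := Lambda_PN_neutral lamN.
have [M_in neutralM] := Lambda_PN_neutral lamM.
have [_ [-> [rowN [deltaN [cvalN _]]]]] := lamN; have [_ [-> [rowM [deltaM [cvalM _]]]]] := lamM.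
split=> //; apply: delta_neutral_inj => //; rewrite ?rowN ?cvalN //.
exact: mat_eq_trans deltaN (mat_eq_sym deltaM).
Qed.

Section LambdaPN.
Variables (n : nat) (A : mat).
Hypothesis A_in : in_A1 n A.

Lemma eq_Lambda_PN B N E : mat_eq n A B -> Lambda_PN n A N E -> Lambda_PN n B N E.
Proof.
move=> eqAB [N_PN [EE [rowE [deltaNA [cvalE' EN0]]]]]; rewrite /Lambda_PN.
rewrite -(eq_Echg A_in eqAB) -(eq_cval A_in eqAB) -(eq_op_row A_in eqAB); do 4!split=> //.
exact: mat_eq_trans deltaNA (eq_delta A_in eqAB).
Qed.

Lemma Lambda_PN_in_N1 N E : Lambda_PN n A N E -> in_N1 n N E.
Proof.
move=> lamA; have [N_in neutralN] := Lambda_PN_neutral lamA.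
have [_ [-> [_ [_ [cvalN _]]]]] := lamA; split=> //; rewrite cvalN.
have := (Echg_ge0 A_in, cval_ge0 A_in, lval_ge0 N_in neutralN); case=> -[]; lia.
Qed.

Lemma Lambda_PN_refl : is_neutral n A -> Lambda_PN n A A 0.
Proof.
move=> neutralA; rewrite /Lambda_PN Echg_neutral // addr0.
by do 2!split=> //; rewrite neutralA orbT.
Qed.

End LambdaPN.

Lemma Lambda_in_N1 n A N E : in_A1 n A -> Lambda n A N E -> in_N1 n N E.
Proof.
move=> A_in; rewrite /Lambda; case: ifP => _; last exact: Lambda_PN_in_N1.
case=> M [lamM eqN]; apply: in_N1_eq (mat_eq_sym eqN) _; rewrite -[E]opprK.
exact/in_N1_bar/(Lambda_PN_in_N1 (in_A1_bar A_in) lamM).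
Qed.

Lemma Lambda_bar n A N E N' E' : in_A1 n A -> Lambda n A N E -> Lambda n (bar n A) N' E' ->
  mat_eq n N' (bar n N) /\ E' = - E.
Proof.
move=> A_in; have barA_in := in_A1_bar A_in; have barbarA_in := in_A1_bar barA_in.
rewrite /Lambda is_negative_bar //; have [[-> ->]|[-> ->]|[-> -> neutralA]] := charge_cases A_in.
- case=> M [lamM eqN] lamN'; have [eqM ->] := Lambda_PN_unique lamN' lamM.
  split=> //; apply: mat_eq_trans eqM _; apply: mat_eq_sym.
  exact: mat_eq_trans (eq_bar eqN) (@bar_bar n M).
- move=> lamN [M [lamM eqN']].
  have [eqM <-] := Lambda_PN_unique (eq_Lambda_PN barbarA_in (@bar_bar n A) lamM) lamN.
  by rewrite opprK; split=> //; apply: mat_eq_trans eqN' (eq_bar eqM).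
- move=> lamN lamN'; have [eqN ->] := Lambda_PN_unique lamN (Lambda_PN_refl A_in neutralA).
  have neutral_bar : is_neutral n (bar n A) by rewrite is_neutral_bar.
  have [eqN' ->] := Lambda_PN_unique lamN' (Lambda_PN_refl barA_in neutral_bar).
  by rewrite oppr0; split=> //; apply: mat_eq_trans eqN' (eq_bar (mat_eq_sym eqN)).
Qed.

Theorem theorem5 (n : nat) (A N : mat) (E : int) (N' : mat) (E' : int) :
  in_A1 n A ->
  Lambda n A N E ->
  Lambda n (bar n A) N' E' ->
  is_dual n (Phi n N E) (Phi n N' E').
Proof.
move=> A_in lamA lam_bar; have NE_in := Lambda_in_N1 A_in lamA.
have [eqN' ->] := Lambda_bar A_in lamA lam_bar.
rewrite -(eq_Phi (mat_eq_sym eqN') (in_N1_bar NE_in)).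
exact: Phi_dual.
Qed.
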